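(* Let $k$ be a positive integer and let $n=2\ell$ for some $\ell\in\{1,\dots,2k\}$. For $\alpha\in\mathbb{R}$ put $\bar\gamma_{n,\alpha}:=\left(\frac{n-2}{2}\right)^2+\left(\frac{\alpha-2}{2}\right)^2$. Then there exists $R>1$ large enough such that $$2^k\left(\prod_{i=0}^{k-1}\bar\gamma_{n,-4i}\right)\cdot\left(\prod_{i=0}^{k-1}\Big(\frac{2i+1}{2}\Big)^2\right)\int_{\mathbb{R}^n\setminus\overline B_R}\frac{\varphi^2}{|x|^{4k}(\log|x|)^{2k}}\,dx\le\int_{\mathbb{R}^n\setminus\overline B_R}|\Delta^k\varphi|^2dx$$ and $$2^{k-2}\left(\prod_{i=0}^{k-1}\bar\gamma_{n,-4i-2}\right)\cdot\left(\prod_{i=0}^{k-1}\Big(\frac{2i+3}{2}\Big)^2\right)\int_{\mathbb{R}^n\setminus\overline B_R}\frac{\varphi^2}{|x|^{4k+2}(\log|x|)^{2k+2}}\,dx\le\int_{\mathbb{R}^n\setminus\overline B_R}|\nabla(\Delta^k\varphi)|^2dx$$ for any $\varphi\in C^\infty_c(\mathbb{R}^n\setminus\overline B_R)$.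
   Context: $B_R$ denotes the open ball in $\mathbb{R}^n$ of radius $R$ centered at the origin. $C^\infty_c(\Omega)$ is the set of smooth functions with support compactly contained in the open set $\Omega$. *)

(* Defs.v *)
From HB Require Import structures.
From mathcomp Require Import all_boot all_order all_algebra.
From mathcomp Require Import all_classical all_reals all_analysis.

Set Implicit Arguments.
Unset Strict Implicit.
Unset Printing Implicit Defensive.

Import Order.TTheory GRing.Theory Num.Theory.
Import numFieldNormedType.Exports.

Local Open Scope classical_set_scope.
Local Open Scope ring_scope.

(* R^n is 'rV[R]_n. The norm carried by the library's normed-module structure
   on 'rV[R]_n is the sup norm: it is used for topology and differentiability
   only; lengths are measured with [enorm]. *)

Section euclidean.
Context {R : realType} {n : nat}.
Implicit Types (f : 'rV[R]_n -> R) (x : 'rV[R]_n).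

Definition enorm x : R := Num.sqrt (\sum_(i < n) x ord0 i ^+ 2).

Definition partial (i : 'I_n) f x : R := 'D_(delta_mx ord0 i) f x.

Definition grad f x : 'rV[R]_n := \row_i partial i f x.

Definition laplacian f x : R := \sum_(i < n) partial i (partial i f) x.

Fixpoint Ck (m : nat) f : Prop :=
  continuous f /\
  if m is m'.+1 then
    forall i : 'I_n,
      (forall x, derivable f x (delta_mx ord0 i)) /\ Ck m' (partial i f)
  else True.

Definition smooth f : Prop := forall m : nat, Ck m f.

Definition tsupp f : set 'rV[R]_n := closure [set x | f x != 0].

(* The space C^oo_c(Omega), Omega open: an element is identified with its
   extension by zero to the whole of R^n. *)
Definition test_function (Omega : set 'rV[R]_n) f : Prop :=
  [/\ smooth f, compact (tsupp f) & tsupp f `<=` Omega].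

End euclidean.

Definition eball {R : realType} (n : nat) (r : R) : set 'rV[R]_n :=
  [set x | enorm x < r].
Arguments eball {R} n r.

Definition exterior {R : realType} (n : nat) (r : R) : set 'rV[R]_n :=
  ~` closure (eball n r).
Arguments exterior {R} n r.

(* Borel sigma-algebra on R^n, generated by the coordinate projections. *)
Section measurable_rV.
Context {R : realType} {n : nat}.

Definition rV_coord (i : 'I_n) (x : 'rV[R]_n) : R := x ord0 i.

Let rV_set0 : g_sigma_preimage rV_coord set0.
Proof. exact: sigma_algebra0. Qed.

Let rV_setC A : g_sigma_preimage rV_coord A -> g_sigma_preimage rV_coord (~` A).
Proof. exact: sigma_algebraC. Qed.

Let rV_bigcup (F : (set 'rV[R]_n)^nat) :
  (forall i, g_sigma_preimage rV_coord (F i)) ->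
  g_sigma_preimage rV_coord (\bigcup_i (F i)).
Proof. exact: sigma_algebra_bigcup. Qed.

HB.instance Definition _ := @isMeasurable.Build default_measure_display
  'rV[R]_n (g_sigma_preimage rV_coord) rV_set0 rV_setC rV_bigcup.

End measurable_rV.

Lemma measurable_rV_coord {R : realType} n (i : 'I_n) :
  measurable_fun [set: 'rV[R]_n] (rV_coord i).
Proof.
move=> _ Y mY; rewrite setTI; apply: sub_sigma_algebra => /=.
rewrite -bigcup_seq/=; exists i => /=; first by rewrite mem_index_enum.
by exists Y => //; rewrite setTI.
Qed.

Lemma measurable_fun_rVP {R : realType} d (T : measurableType d) n
    (f : T -> 'rV[R]_n) :
  (forall i, measurable_fun [set: T] (fun t => f t ord0 i)) ->
  measurable_fun [set: T] f.
Proof.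
move=> mf.
suff: g_sigma_preimage (fun i => rV_coord i \o f) `<=` measurable.
  rewrite g_sigma_preimage_comp => prefS _ A mA.
  by apply: prefS; exists A.
case: n => [|n] in f mf *.
  apply: smallest_sub; first exact: sigma_algebra_measurable.
  by rewrite big_ord0.
apply: smallest_sub; first exact: sigma_algebra_measurable.
rewrite -bigcup_mkord_ord; apply: bigcup_sub => i Ii.
by move=> A [B mB <-]; exact: mf.
Qed.

Definition rV_cons {R : realType} {n} (p : R * 'rV[R]_n) : 'rV[R]_n.+1 :=
  row_mx p.1%:M p.2.

Definition rV_uncons {R : realType} {n} (x : 'rV[R]_n.+1) : R * 'rV[R]_n :=
  (x ord0 ord0, \row_i x ord0 (lift ord0 i)).

Lemma rV_consK {R : realType} n : cancel (@rV_cons R n) rV_uncons.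
Proof.
case=> a x; rewrite /rV_uncons /rV_cons /=; congr pair.
  by rewrite mxE; case: splitP => // j _; rewrite !ord1 mxE.
apply/rowP => i; rewrite !mxE; case: splitP => j /=.
  by rewrite ord1.
by rewrite /bump /= !add1n => -[] ij; congr (x _ _); apply: val_inj.
Qed.

Lemma rV_unconsK {R : realType} n : cancel (@rV_uncons R n) rV_cons.
Proof.
move=> x; apply/rowP => i; rewrite !mxE; case: splitP => j ij.
  rewrite !mxE !ord1 /=; congr (x _ _); apply: val_inj => /=.
  by rewrite ij ord1.
rewrite mxE; congr (x _ _); apply: val_inj => /=.
by rewrite ij.
Qed.

Lemma measurable_rV_cons {R : realType} n :
  measurable_fun [set: R * 'rV[R]_n] (@rV_cons R n).
Proof.
apply: measurable_fun_rVP => i.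
have [->|[j ->]] : i = ord0 \/ exists j, i = lift ord0 j.
  by case: (unliftP ord0 i) => [j ->|->]; [right; exists j|left].
  rewrite [X in measurable_fun _ X](_ : _ = fst); first exact: measurable_fst.
  by apply/funext => p; exact: (congr1 fst (rV_consK p)).
rewrite [X in measurable_fun _ X](_ : _ = rV_coord j \o snd).
  by apply: measurableT_comp; [exact: measurable_rV_coord|exact: measurable_snd].
apply/funext => p /=; rewrite /rV_coord.
have /(congr1 snd)/rowP/(_ j) /= := rV_consK p.
by rewrite mxE.
Qed.

Lemma measurable_rV_uncons {R : realType} n :
  measurable_fun [set: 'rV[R]_n.+1] (@rV_uncons R n).
Proof.
apply/measurable_fun_pair; first exact: measurable_rV_coord.
apply: measurable_fun_rVP => i.
rewrite [X in measurable_fun _ X](_ : _ = rV_coord (lift ord0 i)).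
  exact: measurable_rV_coord.
by apply/funext => x; rewrite mxE.
Qed.

(* n-dimensional Lebesgue measure, as an iterated product measure. *)
Fixpoint lebesgue_rV (R : realType) (n : nat) : set 'rV[R]_n -> \bar R :=
  if n is n'.+1 return set 'rV[R]_n -> \bar R then
    pushforward (@lebesgue_measure R \x @lebesgue_rV R n')%E (@rV_cons R n')
  else dirac (0%R : 'rV[R]_0).
Arguments lebesgue_rV R n : clear implicits.

Section lebesgue_step.
Context {R : realType} (n : nat).
Variable mu : {sigma_finite_measure set 'rV[R]_n -> \bar R}.
Local Open Scope ereal_scope.

Definition lebesgue_step : set 'rV[R]_n.+1 -> \bar R :=
  pushforward (@lebesgue_measure R \x mu) (@rV_cons R n).

Let lebesgue_step0 : lebesgue_step set0 = 0.
Proof. by rewrite /lebesgue_step /pushforward preimage_set0 measure0. Qed.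

Let lebesgue_step_ge0 A : 0 <= lebesgue_step A.
Proof. by rewrite /lebesgue_step /pushforward; exact: measure_ge0. Qed.

Let lebesgue_step_sigma_additive : semi_sigma_additive lebesgue_step.
Proof.
have mpre A : measurable A -> measurable (@rV_cons R n @^-1` A).
  by move=> mA; rewrite -[X in measurable X]setTI; exact: measurable_rV_cons.
move=> F mF tF mUF; rewrite /lebesgue_step /pushforward preimage_bigcup.
apply: measure_semi_sigma_additive.
- by move=> i; exact: mpre.
- apply/trivIsetP => /= i j _ _ ij; rewrite -preimage_setI.
  by move/trivIsetP : tF => /(_ _ _ _ _ ij) ->//; rewrite preimage_set0.
- by rewrite -preimage_bigcup; exact: mpre.
Qed.

HB.instance Definition _ := isMeasure.Build _ _ _ lebesgue_step
  lebesgue_step0 lebesgue_step_ge0 lebesgue_step_sigma_additive.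

Let lebesgue_step_sigma_finite : sigma_finite setT lebesgue_step.
Proof.
have /sigma_finiteP[F [FT ndF Foo]] := sigma_finiteT (@lebesgue_measure R).
have /sigma_finiteP[G [GT ndG Goo]] := sigma_finiteT mu.
exists (fun i => @rV_uncons R n @^-1` (F i `*` G i)).
  apply/esym; rewrite -subTset => x _.
  have [i _ Fi] : (\bigcup_i F i) (rV_uncons x).1 by rewrite -FT.
  have [j _ Gj] : (\bigcup_i G i) (rV_uncons x).2 by rewrite -GT.
  exists (maxn i j) => //; split.
    by move: Fi; apply/subsetPset/ndF/leq_maxl.
  by move: Gj; apply/subsetPset/ndG/leq_maxr.
move=> i; have [mF Fi] := Foo i; have [mG Gi] := Goo i; split.
  rewrite -[X in measurable X]setTI; apply: measurable_rV_uncons => //.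
  exact: measurableX.
rewrite /lebesgue_step /pushforward -comp_preimage.
rewrite (_ : _ \o _ = idfun); last by apply/funext => p; exact: rV_consK.
rewrite preimage_id product_measure1E// lte_mul_pinfty// ge0_fin_numE//.
Qed.

HB.instance Definition _ := Measure_isSigmaFinite.Build _ _ _ lebesgue_step
  lebesgue_step_sigma_finite.

End lebesgue_step.

Section lebesgue_rV_measure.
Context (R : realType) (n : nat).
Local Open Scope ereal_scope.

Let lebesgue_rV_ex :
  exists mu : {sigma_finite_measure set 'rV[R]_n -> \bar R},
    mu = lebesgue_rV R n :> (set 'rV[R]_n -> \bar R).
Proof.
elim: n => [|n' [mu muE]]; first by exists (@dirac _ 'rV[R]_0 0%R R).
by exists (lebesgue_step mu); rewrite /= -muE.
Qed.

Let lebesgue_rV0 : lebesgue_rV R n set0 = 0.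
Proof. by have [mu <-] := lebesgue_rV_ex; exact: measure0. Qed.

Let lebesgue_rV_ge0 A : 0 <= lebesgue_rV R n A.
Proof. by have [mu <-] := lebesgue_rV_ex; exact: measure_ge0. Qed.

Let lebesgue_rV_sigma_additive : semi_sigma_additive (lebesgue_rV R n).
Proof.
by have [mu <-] := lebesgue_rV_ex; exact: measure_semi_sigma_additive.
Qed.

HB.instance Definition _ := isMeasure.Build _ _ _ (lebesgue_rV R n)
  lebesgue_rV0 lebesgue_rV_ge0 lebesgue_rV_sigma_additive.

Let lebesgue_rV_sigma_finite : sigma_finite setT (lebesgue_rV R n).
Proof. by have [mu <-] := lebesgue_rV_ex; exact: sigma_finiteT. Qed.

HB.instance Definition _ := Measure_isSigmaFinite.Build _ _ _ (lebesgue_rV R n)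
  lebesgue_rV_sigma_finite.

End lebesgue_rV_measure.

Definition gammabar {R : realType} (n : nat) (alpha : R) : R :=
  ((n%:R - 2) / 2) ^+ 2 + ((alpha - 2) / 2) ^+ 2.

(* Main.v *)
Require Import Defs.
From mathcomp Require Import all_boot all_order all_algebra.
From mathcomp Require Import all_classical all_reals all_analysis.
From mathcomp Require Import measurable_realfun zify ring lra.

Set Implicit Arguments.
Unset Strict Implicit.
Unset Printing Implicit Defensive.

Import Order.TTheory GRing.Theory Num.Theory.
Import numFieldNormedType.Exports.

Local Open Scope classical_set_scope.
Local Open Scope ring_scope.

(** Let t = log |x|, let E = x . grad, and let S be the Laplacian of the spheres
    centred at 0, so that |x|^2 Delta = E^2 + (n - 2) E + S ([sphE]).

    Both inequalities are iterations of one step ([rellich_step]), which bounds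
    the integral of |x|^alpha t^c (Delta u)^2 from below by a multiple of that of
    |x|^(alpha - 4) t^(c - 2) u^2. Put A = (n - 2) / 2, B = (alpha - 2) / 2 and
    u = |x|^-(A + B) w. The first integral becomes that of
    t^c (E^2 w - 2 B E w + M w)^2 against dx / |x|^n, with M = B^2 - A^2 + S. This
    measure is invariant under dilations and rotations, so E is antisymmetric up
    to the derivative of t^c and S is symmetric. Expanding the square and
    integrating by parts ([weighted_rellich]) leaves 2 (A^2 + B^2) times the
    integral of t^c (E w)^2, to which a one-dimensional Hardy inequality with
    constant ((1 - c) / 2)^2 applies ([weighted_hardy]), some nonnegative terms,
    and the terms t^c (M w)^2 + k(t) w (M w), where k(t) / t^c tends to 0 at
    infinity.

    The sign of the last two terms is the crucial point. As n is even and alpha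
    is an even integer, A and B are integers, the eigenvalues of - S are the
    integers d (d + n - 2), and no eigenvalue of M lies strictly between -1 and 0.
    Hence M (M + 1) >= 0 ([sph_spectral_gap]), and k(t) w (M w) is absorbed by
    t^c (M w)^2 as soon as t is large; this is why the radius has to be large.

    The spectral gap is obtained from polynomials. If q is homogeneous of degree
    d, then (S + d (d + n - 2)) q = |x|^2 Delta q, so by induction on d every
    polynomial is a sum of eigenfunctions of S ([hpoly_eigsum]). Multiplied by a
    radial cutoff they are orthogonal, by Bernstein's theorem they approximate
    every continuous function ([weierstrass_cube]), and Bessel's inequality
    concludes ([spectral_gap_approx]).

    The first inequality uses the steps alpha = - 4 i, c = - 2 i for i < k, and the
    second one the steps alpha = - 4 i - 2, c = - 2 i - 2 after a Hardy inequality
    for the gradient ([gradient_hardy]) with constant 1/4. *)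

(** * Continuous functions and Lebesgue measure on R^n *)

Section measure_rV.
Context {R : realType}.

Lemma rV_boxE n (x y : 'rV[R]_n) e : 0 < e -> 
  ball x e y <-> forall i, `|x ord0 i - y ord0 i| < e.
Proof.
move=> e0; split.
  by case=> _ + i => /(_ ord0 i).
by move=> h; split => // i j; rewrite ord1; exact: h.
Qed.

(** The measurable sets are generated by the coordinates: an open set is the
    union of the countably many rational boxes that it contains. *)
Lemma open_measurable_rV n (A : set 'rV[R]_n) : open A -> measurable A.
Proof.
move=> oA.
pose box (p : 'rV[rat]_n * rat) : set 'rV[R]_n :=
  [set y | forall i, `|ratr (p.1 ord0 i) - y ord0 i| < ratr p.2].
have mbox p : measurable (box p).
  rewrite (_ : box p = \bigcap_(i in [set: 'I_n])
     (rV_coord i @^-1` ball (ratr (p.1 ord0 i) : R) (ratr p.2))).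
    apply: fin_bigcap_measurable => // i _; rewrite -[X in measurable X]setTI.
    by apply: measurable_rV_coord => //; exact: measurable_ball.
  by apply/seteqP; split => y By i; [move=> _|]; exact: By.
rewrite (_ : A = \bigcup_(p in [set p | box p `<=` A]) box p).
  rewrite bigcup_mkcond; apply: countable_bigcupT_measurable => [|p].
    exact: countableP.
  by case: ifP.
apply/seteqP; split; last by move=> y [p /= /[apply]].
move=> x Ax.
have /nbhs_ballP[e /= e0 xeA] : nbhs x A by exact: open_nbhs_nbhs.
have [q] : exists q : rat, (ratr q : R) \in `]0, e / 2[.
  by apply: rat_in_itvoo; rewrite divr_gt0.
rewrite in_itv /= => /andP[q0 qe].
have near_x i : exists c : rat, `|ratr c - x ord0 i| < ratr q.
  have [c] : exists c : rat, (ratr c : R) \in `]x ord0 i - ratr q, x ord0 i + ratr q[.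
    apply: rat_in_itvoo; lra.
  by rewrite in_itv /= => xc; exists c; rewrite ltr_distl.
have [c hc] := choice near_x.
exists (\row_i c i, q); last by move=> i; rewrite /= mxE.
move=> y /= By; apply: xeA; apply/rV_boxE => // i.
have := By i; rewrite mxE => ?.
have := hc i => ?.
rewrite (le_lt_trans (ler_distD (ratr (c i)) _ _))//.
rewrite (distrC (x ord0 i)); lra.
Qed.

Lemma continuous_measurable_rV n (f : 'rV[R]_n -> R) :
  continuous f -> measurable_fun setT f.
Proof.
move=> /continuousP cf; apply: (measurability _ (RGenOpens.measurableE R)).
move=> _ [_ [a [b ->] <-]]; rewrite setTI; apply: open_measurable_rV.
exact/cf/interval_open.
Qed.


Definition cube n (T : R) : set 'rV[R]_n := [set x | forall i, `|x ord0 i| <= T].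

Lemma measurable_cube n T : measurable (@cube n T).
Proof.
rewrite (_ : cube _ = \bigcap_(i in [set: 'I_n]) (rV_coord i @^-1` `[- T, T])).
  apply: fin_bigcap_measurable => // i _; rewrite -[X in measurable X]setTI.
  by apply: measurable_rV_coord => //; exact: measurable_itv.
by apply/seteqP; split => y By i; [move=> _|];
  have := By i; rewrite /= in_itv /= -ler_norml //; apply.
Qed.

Lemma lebesgue_rV_cube n T : (lebesgue_rV R n (@cube n T) < +oo)%E.
Proof.
elim: n => [|n IH] /=; first by rewrite /dirac/= indicE ltry.
rewrite /pushforward.
rewrite (_ : _ @^-1` _ = `[- T, T]%classic `*` @cube n T).
  rewrite product_measure1E //; last exact: measurable_cube.
  rewrite lte_mul_pinfty // ge0_fin_numE //.
  by rewrite /= lebesgue_measure_itv /=; case: ifP => _; rewrite ?ltry // -EFinD ltry.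
apply/seteqP; split => -[a y] /=.
  move=> h; split.
    by have := h ord0; rewrite (_ : rV_cons _ _ _ = a) ?in_itv -?ler_norml //; exact: (congr1 fst (rV_consK (a, y))).
  move=> i; have := h (lift ord0 i).
  by have /(congr1 snd)/rowP/(_ i) /= := rV_consK (a, y); rewrite mxE => ->.
move=> [+ h]; rewrite in_itv -ler_norml => ha i.
case: (unliftP ord0 i) => [j ->|->].
  by have /(congr1 snd)/rowP/(_ j) /= := rV_consK (a, y); rewrite mxE => ->; exact: h.
by rewrite (_ : rV_cons _ _ _ = a) //; exact: (congr1 fst (rV_consK (a, y))).
Qed.

(** Supports are controlled by cubes, whose measure is computed by the
    recursion that defines [lebesgue_rV]. *)
Definition bsupp n (f : 'rV[R]_n -> R) := exists T, forall x, ~ cube T x -> f x = 0.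

Lemma compact_cube n T : compact (@cube n T).
Proof.
rewrite (_ : cube _ = [set v | forall i, `[- T, T]%classic (v ord0 i)]).
  by apply: (@rV_compact _ _ (fun=> `[- T, T]%classic)) => i; exact: segment_compact.
by apply/seteqP; split => v /= vi i; have := vi i; rewrite in_itv /= ler_norml.
Qed.

Lemma integrable_rV n (f : 'rV[R]_n -> R) : continuous f -> bsupp f ->
  (lebesgue_rV R n).-integrable setT (EFin \o f).
Proof.
move=> cf [T fT].
have mf := continuous_measurable_rV cf.
have -> : f = f \_ (cube T).
  apply/funext => x; rewrite patchE; case: ifPn => //.
  by rewrite notin_setE => /fT.
rewrite -restrict_EFin; apply/integrable_restrict => //=.
  exact: measurable_cube.
rewrite setTI; apply: measurable_bounded_integrable => //.
- exact: measurable_cube.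
- exact: lebesgue_rV_cube.
- exact: measurable_funTS.
- have /compact_bounded [M [Mr hM]]: compact (f @` cube T).
    apply: continuous_compact; last exact: compact_cube.
    exact: continuous_subspaceT.
  by exists M; split => // N /hM {}hM x cx; apply: hM; exists x.
Qed.

End measure_rV.

(** * Integrals of partial derivatives *)

Section div_rV.
Context {R : realType}.

Lemma continuous_rV (T : topologicalType) n (g : T -> 'rV[R]_n) :
  (forall i, continuous (fun t => g t ord0 i)) -> continuous g.
Proof.
move=> cg t A [P Pn PA].
have : \near t, forall i, P ord0 i (g t ord0 i).
  by apply: filter_forall => i; exact: (cg i t _ (Pn ord0 i)).
by apply: filterS => s h; apply: PA => j i; rewrite ord1.
Qed.

Lemma rV_cons0 n (a : R) (y : 'rV[R]_n) : rV_cons (a, y) ord0 ord0 = a.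
Proof. exact: (congr1 fst (rV_consK (a, y))). Qed.

Lemma rV_consS n (a : R) (y : 'rV[R]_n) j :
  rV_cons (a, y) ord0 (lift ord0 j) = y ord0 j.
Proof. by have /(congr1 snd)/rowP/(_ j) /= := rV_consK (a, y); rewrite mxE. Qed.

Lemma continuous_rV_consr n (a : R) : continuous (fun y : 'rV[R]_n => rV_cons (a, y)).
Proof.
apply: continuous_rV => i; case: (unliftP ord0 i) => [j ->|->].
  by under eq_fun do rewrite rV_consS; exact: coord_continuous.
by under eq_fun do rewrite rV_cons0; exact: cst_continuous.
Qed.

Lemma continuous_rV_consl n (y : 'rV[R]_n) : continuous (fun a : R => rV_cons (a, y)).
Proof.
apply: continuous_rV => i; case: (unliftP ord0 i) => [j ->|->].
  by under eq_fun do rewrite rV_consS; exact: cst_continuous.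
by under eq_fun do rewrite rV_cons0; move=> a; exact: cvg_id.
Qed.

(** Difference quotients only see a function along a line, so derivatives can
    be transported between R^n, its slices and the real line. *)
Lemma derive_line (V V' W : normedModType R) (g : V -> W) (f : V' -> W) a u b v :
  (forall h : R, g (h *: u + a) = f (h *: v + b)) ->
  'D_u g a = 'D_v f b /\ (derivable f b v -> derivable g a u).
Proof.
move=> gf; have gf0 : g a = f b by have := gf 0; rewrite !scale0r !add0r.
have E : (fun h : R => h^-1 *: (g (h *: u + a) - g a)) =
         (fun h => h^-1 *: (f (h *: v + b) - f b)).
  by apply/funext => h; rewrite gf gf0.
by rewrite /derive /derivable /= /shift /=; split; rewrite /comp E.
Qed.

Lemma nbhs_notin_cube n T (x : 'rV[R]_n) : ~ cube T x -> \near x, ~ cube T x.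
Proof.
move=> nx; apply: open_nbhs_nbhs; split => //.
have : closed (@cube R n T) by apply: compact_closed; [exact: norm_hausdorff|exact: compact_cube].
by move/closed_openC.
Qed.

Lemma derive_near0 (V W : normedModType R) (f : V -> W) x v :
  (\near x, f x = 0) -> 'D_v f x = 0.
Proof. by move=> f0; rewrite (near_eq_derive v f0); exact: derive_cst. Qed.

Lemma bsupp_partial n (f : 'rV[R]_n -> R) i : bsupp f -> bsupp (partial i f).
Proof.
move=> [T fT]; exists T => x nx.
apply: derive_near0; near=> z; apply: fT.
by near: z; exact: nbhs_notin_cube.
Unshelve. all: by end_near. Qed.

Lemma integral_rV_cons n (f : 'rV[R]_n.+1 -> R) : continuous f -> bsupp f ->
  (\int[lebesgue_rV R n.+1]_x (f x)%:E =
     \int[lebesgue_measure]_a \int[lebesgue_rV R n]_y (f (rV_cons (a, y)))%:E)%E /\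
  (\int[lebesgue_rV R n.+1]_x (f x)%:E =
     \int[lebesgue_rV R n]_y \int[lebesgue_measure]_a (f (rV_cons (a, y)))%:E)%E.
Proof.
move=> cf bf.
have mc := @measurable_rV_cons R n.
have mf : measurable_fun setT (EFin \o f).
  by apply/measurable_EFinP; exact: continuous_measurable_rV.
have /integrableP [_ fi] := integrable_rV cf bf.
pose nu := pushforward (@lebesgue_measure R \x @lebesgue_rV R n)%E (@rV_cons R n).
have int2 : (@lebesgue_measure R \x @lebesgue_rV R n)%E.-integrable setT
    ((EFin \o f) \o @rV_cons R n).
  apply/integrableP; split; first exact: measurableT_comp.
  move: fi.
  rewrite (eq_measure_integral nu) // /nu.
  by rewrite ge0_integral_pushforward ?preimage_setT //; exact: measurableT_comp.
have -> : (\int[lebesgue_rV R n.+1]_x (f x)%:E =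
   \int[(@lebesgue_measure R \x @lebesgue_rV R n)]_x (f (rV_cons x))%:E)%E.
  rewrite (eq_measure_integral nu) // /nu.
  by rewrite integral_pushforward ?preimage_setT.
split; first by rewrite -integral12_prod_meas1.
by rewrite -integral21_prod_meas1.
Qed.

Lemma integral_derive_line (f df : R -> R) (T : R) :
  (forall x : R, is_derive x 1 f (df x)) -> continuous df ->
  (forall x, T < `|x| -> f x = 0) -> (\int[lebesgue_measure]_x (df x)%:E = 0)%E.
Proof.
move=> fdf cdf fT; pose S : R := `|T| + 1.
have S0 : 0 < S by rewrite ltr_wpDl.
have TS : T < S by rewrite (le_lt_trans (ler_norm _))// ltrDl.
have df0 x : S < `|x| -> df x = 0.
  move=> Sx; rewrite -(@derive_val _ _ _ _ _ _ _ (fdf x)).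
  apply: derive_near0; near=> z; apply: fT.
  rewrite (lt_trans TS)//; near: z.
  have : (fun z : R => `|z|) @ x --> `|x| by apply: norm_continuous.
  by move/cvgr_gt; apply.
have cf x : {for x, continuous f}.
  apply: differentiable_continuous; apply/derivable1_diffP.
  exact: ex_derive.
transitivity (\int[lebesgue_measure]_(x in `[(- S)%R, S]) (df x)%:E)%E.
  rewrite [RHS]integral_mkcond; apply: eq_integral => x _.
  rewrite patchE; case: ifPn => //; rewrite notin_setE /= in_itv /= -ler_norml.
  by move=> /negP; rewrite -ltNge => /df0 ->.
rewrite (continuous_FTC2 (F := f)); last first.
- by move=> x _; rewrite derive1E derive_val.
- split.
  + by move=> x _; exact: ex_derive.
  + by apply: cvg_at_right_filter; exact: cf.
  + by apply: cvg_at_left_filter; exact: cf.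
- exact: continuous_subspaceT.
- by rewrite gtrN.
by rewrite !fT ?subee// ?normrN (gtr0_norm S0).
Unshelve. all: by end_near. Qed.

(** Fubini isolates the coordinate i, along which the integrand is the
    derivative of a function with bounded support. *)
Lemma integral_partial n (i : 'I_n) (f : 'rV[R]_n -> R) :
  continuous f -> bsupp f -> (forall x, derivable f x (delta_mx ord0 i)) ->
  continuous (partial i f) ->
  (\int[lebesgue_rV R n]_x (partial i f x)%:E = 0)%E.
Proof.
elim: n i f => [[]//|n IH] i f cf bf df cdf.
have [E1 E2] := integral_rV_cons cdf (bsupp_partial i bf).
have [T fT] := bf.
case: (unliftP ord0 i) => [j ij|i0].
- rewrite E1 integral0_eq // => a _.
  pose g y := f (rV_cons (a, y)).
  have lg h y : g (h *: delta_mx ord0 j + y) = f (h *: delta_mx ord0 i + rV_cons (a, y)).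
    rewrite /g; congr f; apply/rowP => k; rewrite [RHS]mxE.
    case: (unliftP ord0 k) => [l ->|->].
      by rewrite !rV_consS !mxE ij (inj_eq lift_inj).
    by rewrite !rV_cons0 !mxE ij (negbTE (neq_lift _ _)) andbF mulr0 add0r.
  have gp y : partial j g y = partial i f (rV_cons (a, y)).
    by apply: (derive_line _).1 => h; exact: lg.
  under eq_integral do rewrite -gp.
  have cca := @continuous_rV_consr n a.
  apply: IH.
  + by move=> y; apply: continuous_comp; [exact: cca|exact: cf].
  + exists T => y ny; apply: fT => cy; apply: ny => k.
    by have := cy (lift ord0 k); rewrite rV_consS.
  + move=> y; apply: (derive_line _).2 (df (rV_cons (a, y))) => h; exact: lg.
  + rewrite (_ : partial j g = partial i f \o (fun y => rV_cons (a, y))).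
      by move=> y; apply: continuous_comp; [exact: cca|exact: cdf].
    by apply/funext => y; exact: gp.
- rewrite E2 integral0_eq // => y _.
  pose g a := f (rV_cons (a, y)).
  have lg (h a : R) : g (h *: 1 + a) = f (h *: delta_mx ord0 i + rV_cons (a, y)).
    rewrite /g; congr f; apply/rowP => k; rewrite [RHS]mxE i0.
    case: (unliftP ord0 k) => [l ->|->].
      by rewrite !rV_consS !mxE (eq_sym (lift _ _)) (negbTE (neq_lift _ _)) andbF mulr0 add0r.
    by rewrite !rV_cons0 !mxE !eqxx.
  apply: (@integral_derive_line g _ T).
  + move=> a; apply: DeriveDef.
      apply: (derive_line _).2 (df (rV_cons (a, y))) => h; exact: lg.
    by apply: (derive_line _).1 => h; exact: lg.
  + move=> a; apply: (@continuous_comp _ _ _ (fun a => rV_cons (a, y)) (partial i f)); last exact: cdf.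
    exact: continuous_rV_consl.
  + move=> a Ta; apply: fT => /(_ ord0); rewrite rV_cons0; lra.
Qed.
End div_rV.

(** * Partial derivatives and local regularity *)

Section calculus.
Context {R : realType} {n : nat}.
Implicit Types (f g : 'rV[R]_n -> R) (x : 'rV[R]_n) (U V : set 'rV[R]_n).
Local Notation e i := (delta_mx ord0 i : 'rV[R]_n).

Lemma partialD f g i x : derivable f x (e i) -> derivable g x (e i) ->
  partial i (fun y => f y + g y) x = partial i f x + partial i g x.
Proof. exact: deriveD. Qed.

Lemma partialM f g i x : derivable f x (e i) -> derivable g x (e i) ->
  partial i (fun y => f y * g y) x = partial i f x * g x + f x * partial i g x.
Proof.
by move=> df dg; rewrite /partial (deriveM df dg) addrC mulrC.
Qed.

Lemma partialZ f a i x : derivable f x (e i) ->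
  partial i (fun y => a * f y) x = a * partial i f x.
Proof. by move=> df; exact: (deriveZ a df). Qed.

Lemma partialN f i x : derivable f x (e i) ->
  partial i (fun y => - f y) x = - partial i f x.
Proof. by move=> df; exact: (deriveN df). Qed.

Lemma partial_cst i a x : partial i (fun=> a) x = 0.
Proof. exact: derive_cst. Qed.

Lemma partial_sum (I : Type) (s : seq I) (F : I -> 'rV[R]_n -> R) i x :
  (forall k, derivable (F k) x (e i)) ->
  derivable (fun y => \sum_(k <- s) F k y) x (e i) /\
  partial i (fun y => \sum_(k <- s) F k y) x = \sum_(k <- s) partial i (F k) x.
Proof.
move=> dF; elim: s => [|k s [ds Ds]].
  rewrite (_ : (fun _ => _) = fun=> 0) ?big_nil; last by apply/funext => y; rewrite big_nil.
  by split; [exact: derivable_cst|exact: partial_cst].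
rewrite (_ : (fun _ => _) = fun y => F k y + \sum_(k <- s) F k y); last first.
  by apply/funext => y; rewrite big_cons.
by split; [exact: derivableD|rewrite big_cons -Ds partialD].
Qed.

Lemma coord_line j i x (h : R) : (h *: e i + x) ord0 j = x ord0 j + h * (i == j)%:R.
Proof. by rewrite !mxE eqxx /= eq_sym addrC. Qed.

Lemma is_derive_coord j i x : is_derive x (e i) (fun y : 'rV[R]_n => y ord0 j) (i == j)%:R.
Proof.
pose g (h : R) := x ord0 j + h * (i == j)%:R.
have lg (h : R) : (h *: e i + x) ord0 j = g (h *: 1 + 0).
  by rewrite coord_line /g addr0 [h%:A]mulr1.
have dg : is_derive (0 : R) 1 g (i == j)%:R.
  rewrite (_ : g = cst (x ord0 j) + (i == j)%:R *: id); last first.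
    by apply/funext => h; rewrite /g mulrC.
  have := is_deriveD (is_derive_cst (x ord0 j) (0 : R) 1)
    (is_deriveZ (i == j)%:R (is_derive_id (0 : R) 1)).
  by rewrite add0r [_%:A]mulr1.
have [D1 D2] := @derive_line _ _ _ _ (fun y : 'rV[R]_n => y ord0 j) _ _ _ _ _ lg.
apply: DeriveDef; first exact: (D2 (@ex_derive _ _ _ _ _ _ _ dg)).
by rewrite D1 (@derive_val _ _ _ _ _ _ _ dg).
Qed.

Lemma is_derive_comp1 (h : R -> R) (dh : R) f x v (df : R) :
  is_derive (f x) 1 h dh -> is_derive x v f df ->
  is_derive x v (fun y => h (f y)) (dh * df).
Proof.
move=> Hh Hf.
have lf (s : R) : (fun s : R => f (s *: v + x)) (s *: 1 + 0) = f (s *: v + x).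
  by rewrite addr0 [s%:A]mulr1.
have [D1 D2] := @derive_line _ _ _ _ (fun s : R => f (s *: v + x)) _ _ _ _ _ lf.
have Hg : is_derive (0 : R) 1 (fun s : R => f (s *: v + x)) df.
  apply: DeriveDef; first exact: (D2 (@ex_derive _ _ _ _ _ _ _ Hf)).
  by rewrite D1 (@derive_val _ _ _ _ _ _ _ Hf).
have Hc : is_derive (0 : R) 1 (h \o (fun s : R => f (s *: v + x))) (dh * df).
  by apply: is_derive1_comp => //; rewrite scale0r add0r.
have lc (s : R) : h (f (s *: v + x)) = (h \o (fun s : R => f (s *: v + x))) (s *: 1 + 0).
  by rewrite /= addr0 [s%:A]mulr1.
have [D3 D4] := @derive_line _ _ _ _ (fun y => h (f y)) _ _ _ _ _ lc.
apply: DeriveDef; first exact: (D4 (@ex_derive _ _ _ _ _ _ _ Hc)).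
by rewrite D3 (@derive_val _ _ _ _ _ _ _ Hc).
Qed.


(** Regularity on a set only: powers of log |x| are smooth where |x| > 1, and
    this is where they multiply functions of compact support. *)
Fixpoint CkOn U (m : nat) f : Prop :=
  (forall x, U x -> {for x, continuous f}) /\
  if m is m'.+1 then
    forall i : 'I_n, (forall x, U x -> derivable f x (e i)) /\ CkOn U m' (partial i f)
  else True.

Definition smoothOn U f := forall m, CkOn U m f.

Lemma CkOnT m f : CkOn setT m f <-> Ck m f.
Proof.
elim: m f => [|m IH] f /=; first by split => -[h _]; split => // x *; exact: h.
split => -[h H]; split.
- by move=> x; exact: h.
- by move=> i; have [d c] := H i; split; [move=> x; exact: d|exact/IH].
- by move=> x _; exact: h.
- by move=> i; have [d c] := H i; split; [move=> x _; exact: d|exact/IH].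
Qed.

Lemma smoothOnT f : smoothOn setT f <-> smooth f.
Proof. by split => h m; apply/CkOnT. Qed.

Lemma CkOn_derivable U m f : CkOn U m.+1 f -> forall x i, U x -> derivable f x (e i).
Proof. by move=> [_ h] x i; exact: (h i).1. Qed.

Lemma CkOn_partial U m f i : CkOn U m.+1 f -> CkOn U m (partial i f).
Proof. by move=> [_ h]; exact: (h i).2. Qed.

Lemma smoothOn_derivable U f : smoothOn U f -> forall x i, U x -> derivable f x (e i).
Proof. by move=> sf; exact: (CkOn_derivable (sf 1%N)). Qed.

Lemma smoothOn_partial U f i : smoothOn U f -> smoothOn U (partial i f).
Proof. by move=> sf m; exact: (CkOn_partial _ (sf m.+1)). Qed.

Lemma CkOn_sub U V m f : V `<=` U -> CkOn U m f -> CkOn V m f.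
Proof.
move=> VU; elim: m f => [|m IH] f /= [c h]; split => //; try by move=> x /VU; exact: c.
by move=> i; have [d k] := h i; split; [move=> x /VU; exact: d|exact: IH].
Qed.

Lemma CkOnU U V m f : CkOn U m f -> CkOn V m f -> CkOn (U `|` V) m f.
Proof.
elim: m f => [|m IH] f /= [c h] [c' h']; split => //; try by move=> x []; [exact: c|exact: c'].
move=> i; have [d k] := h i; have [d' k'] := h' i; split; last exact: IH.
by move=> x []; [exact: d|exact: d'].
Qed.

Lemma CkOn_mon U m f : CkOn U m.+1 f -> CkOn U m f.
Proof.
elim: m f => [|m IH] f; first by move=> [c _]; split.
move=> [c h]; split => // i; have [d k] := h i; split => //; exact: IH.
Qed.

Lemma nbhs_eqfun U f g x : open U -> U x -> (forall y, U y -> f y = g y) ->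
  \near x, f x = g x.
Proof. by move=> oU Ux fg; near=> y; apply: fg; near: y; exact: open_nbhs_nbhs.
Unshelve. all: by end_near. Qed.

Lemma continuous_near_eq (T S : topologicalType) (f g : T -> S) (x : T) :
  (\near x, f x = g x) -> {for x, continuous f} -> {for x, continuous g}.
Proof.
move=> fg; rewrite /prop_for /continuous_at -(nbhs_singleton fg).
apply: cvg_trans; apply: near_eq_cvg; exact: fg.
Qed.

Lemma CkOn_eq U m f g : open U -> (forall x, U x -> f x = g x) ->
  CkOn U m f -> CkOn U m g.
Proof.
move=> oU; elim: m f g => [|m IH] f g fg.
  by move=> [c _]; split => // x Ux; apply: continuous_near_eq (c x Ux); exact: (nbhs_eqfun oU Ux fg).
move=> [c h]; split.
  by move=> x Ux; apply: continuous_near_eq (c x Ux); exact: (nbhs_eqfun oU Ux fg).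
move=> i; have [d k] := h i; split.
  move=> x Ux; apply: near_eq_derivable (d x Ux); exact: (nbhs_eqfun oU Ux fg).
apply: IH k => x Ux; apply: near_eq_derive; exact: (nbhs_eqfun oU Ux fg).
Qed.

Lemma CkOn_cst U m (a : R) : CkOn U m (fun=> a).
Proof.
elim: m a => [|m IH] a /=; split => //; try by move=> x _; exact: cst_continuous.
move=> i; split; first by move=> x _; exact: derivable_cst.
rewrite (_ : partial i _ = fun=> 0); first exact: IH.
by apply/funext => x; exact: partial_cst.
Qed.

Lemma CkOn_coord U m i : CkOn U m (fun x => x ord0 i).
Proof.
case: m => [|m] /=; split => //; try by move=> x _; exact: coord_continuous.
move=> j; split; first by move=> x _; have := is_derive_coord i j x => /(@ex_derive _ _ _ _ _ _ _).
rewrite (_ : partial j _ = fun=> (j == i)%:R); first exact: CkOn_cst.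
by apply/funext => x; exact: (@derive_val _ _ _ _ _ _ _ (is_derive_coord i j x)).
Qed.

Lemma CkOnD U m f g : open U -> CkOn U m f -> CkOn U m g -> CkOn U m (fun x => f x + g x).
Proof.
move=> oU; elim: m f g => [|m IH] f g [c h] [c' h']; split => //;
  try by move=> x Ux; apply: continuousD; [exact: c|exact: c'].
move=> i; have [d k] := h i; have [d' k'] := h' i; split.
  by move=> x Ux; apply: derivableD; [exact: d|exact: d'].
apply: CkOn_eq (IH _ _ k k') => // x Ux.
by rewrite partialD //; [exact: d|exact: d'].
Qed.

Lemma CkOnM U m f g : open U -> CkOn U m f -> CkOn U m g -> CkOn U m (fun x => f x * g x).
Proof.
move=> oU; elim: m f g => [|m IH] f g hf hg.
  have [[c _] [c' _]] := (hf, hg); split => //.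
  by move=> x Ux; apply: continuousM; [exact: c|exact: c'].
have [[c h] [c' h']] := (hf, hg); split.
  by move=> x Ux; apply: continuousM; [exact: c|exact: c'].
move=> i; have [d k] := h i; have [d' k'] := h' i; split.
  by move=> x Ux; apply: derivableM; [exact: d|exact: d'].
have H := CkOnD oU (IH _ _ k (CkOn_mon hg)) (IH _ _ (CkOn_mon hf) k').
apply: CkOn_eq H => // x Ux.
by rewrite partialM //; [exact: d|exact: d'].
Qed.

Lemma CkOn_sum U m (I : Type) (s : seq I) (F : I -> 'rV[R]_n -> R) :
  open U -> (forall k, CkOn U m (F k)) -> CkOn U m (fun x => \sum_(k <- s) F k x).
Proof.
move=> oU hF; elim: s => [|k s IH].
  rewrite (_ : (fun _ => _) = fun=> 0); first exact: CkOn_cst.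
  by apply/funext => y; rewrite big_nil.
rewrite (_ : (fun _ => _) = fun y => F k y + \sum_(k <- s) F k y).
  exact: CkOnD.
by apply/funext => y; rewrite big_cons.
Qed.

End calculus.

(** * Symmetry of second derivatives *)

Section calculus.
Context {R : realType} {n : nat}.
Implicit Types (f g : 'rV[R]_n -> R) (x : 'rV[R]_n) (U V : set 'rV[R]_n).
Local Notation e i := (delta_mx ord0 i : 'rV[R]_n).

Lemma is_derive_line f v y (s : R) : derivable f (s *: v + y) v ->
  is_derive s 1 (fun t => f (t *: v + y)) ('D_v f (s *: v + y)).
Proof.
move=> df.
have lf (h : R) : (fun t => f (t *: v + y)) (h *: 1 + s) = f (h *: v + (s *: v + y)).
  by rewrite [h%:A]mulr1 scalerDl addrA.
have [D1 D2] := @derive_line _ _ _ _ (fun t : R => f (t *: v + y)) f _ _ _ _ lf.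
by apply: DeriveDef; [exact: D2|exact: D1].
Qed.

Lemma mvt0 (f df : R -> R) (h : R) : 0 < h -> (forall s : R, is_derive s 1 f (df s)) ->
  exists2 c, 0 <= c <= h & f h - f 0 = df c * h.
Proof.
move=> h0 dfE.
have cf : {within `[0, h], continuous f}.
  by apply: derivable_within_continuous => s _; exact: (@ex_derive _ _ _ _ _ _ _ (dfE s)).
have [c + ->] := MVT_segment (ltW h0) (fun s _ => dfE s) cf.
by rewrite in_itv /= => hc; exists c => //; rewrite subr0.
Qed.

(** The mean value theorem is applied in direction i and then in direction j;
    the left-hand side is symmetric in i and j. *)
Lemma second_difference f i j x h : Ck 2 f -> 0 < h ->
  exists c d, [/\ 0 <= c <= h, 0 <= d <= h &
   f (h *: e i + (h *: e j + x)) - f (h *: e j + x) - (f (h *: e i + x) - f x) =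
   partial j (partial i f) (d *: e j + (c *: e i + x)) * h * h].
Proof.
move=> [_ /(_ i) [di [_ /(_ j) [dji _]]]] h0.
pose phi (s : R) := f (s *: e i + (h *: e j + x)) - f (s *: e i + x).
have dphi (s : R) : is_derive s 1 phi
    (partial i f (s *: e i + (h *: e j + x)) - partial i f (s *: e i + x)).
  by apply: is_deriveB; apply: is_derive_line; exact: di.
have [c hc Ec] := mvt0 h0 dphi.
pose psi (t : R) := partial i f (t *: e j + (c *: e i + x)).
have dpsi (t : R) : is_derive t 1 psi (partial j (partial i f) (t *: e j + (c *: e i + x))).
  by apply: is_derive_line; exact: dji.
have [d hd Ed] := mvt0 h0 dpsi.
exists c, d; split => //; rewrite -Ed.
have sw (a b : R) : a *: e i + (b *: e j + x) = b *: e j + (a *: e i + x) by rewrite addrCA.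
move: Ec; rewrite /phi /psi !scale0r !add0r => Ec.
by rewrite -(sw c h) -Ec; lra.
Qed.

Lemma continuous_close_eq (F G : 'rV[R]_n -> R) x :
  {for x, continuous F} -> {for x, continuous G} ->
  (forall dl, 0 < dl -> exists y z, [/\ ball x dl y, ball x dl z & F y = G z]) ->
  F x = G x.
Proof.
move=> cF cG H; apply/eqP; rewrite -subr_eq0 -normr_le0 leNgt; apply/negP => e0.
pose ep := `|F x - G x| / 2; have ep0 : 0 < ep by rewrite divr_gt0.
have /nbhs_ballP[dl /= dl0 hdl] :
    nbhs x ([set y | `|F x - F y| < ep] `&` [set y | `|G x - G y| < ep]).
  apply: filterI.
    by move/cvgrPdist_lt : cF; apply.
  by move/cvgrPdist_lt : cG; apply.
have [y [z [/hdl [Fy _] /hdl [_ Gz] E]]] := H _ dl0.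
have : `|F x - G x| < ep + ep.
  rewrite (le_lt_trans (ler_distD (F y) _ _))//.
  by rewrite ltrD// E distrC.
by rewrite /ep -splitr ltxx.
Qed.

Lemma ball_two_steps x (dl c d : R) p q : 0 < dl ->
  0 <= c <= dl / 4 -> 0 <= d <= dl / 4 -> ball x dl (d *: e p + (c *: e q + x)).
Proof.
move=> dl0 /andP[c0 ch] /andP[d0 dh]; apply/rV_boxE => // k.
rewrite !coord_line; set b1 := _%:R; set b2 := _%:R.
have b1E : 0 <= b1 <= 1 by rewrite ler0n lern1 leq_b1.
have b2E : 0 <= b2 <= 1 by rewrite ler0n lern1 leq_b1.
have H2 : 0 <= d * b2 <= d by case/andP: b2E => *; rewrite mulr_ge0 ?ler_piMr.
have H1 : 0 <= c * b1 <= c by case/andP: b1E => *; rewrite mulr_ge0 ?ler_piMr.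
move: (d * b2) (c * b1) H1 H2 => u v /andP[H1 H2] /andP[H3 H4].
rewrite ltr_norml; apply/andP; split; lra.
Qed.

(** Both mixed derivatives are values, at points close to x, of one and the same
    second difference quotient. *)
Lemma partialC f i j x : Ck 2 f ->
  partial i (partial j f) x = partial j (partial i f) x.
Proof.
move=> f2; apply: continuous_close_eq.
- by have [_ /(_ j)[_ [_ /(_ i)[_ [c _]]]]] := f2; exact: c.
- by have [_ /(_ i)[_ [_ /(_ j)[_ [c _]]]]] := f2; exact: c.
move=> dl dl0; have h0 : 0 < dl / 4 by rewrite divr_gt0.
move: (dl / 4) h0 (@ball_two_steps x dl) => h h0 inball.
have [c [d [hc hd E1]]] := second_difference i j x f2 h0.
have [c' [d' [hc' hd' E2]]] := second_difference j i x f2 h0.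
exists (d' *: e i + (c' *: e j + x)), (d *: e j + (c *: e i + x)); split.
- exact: inball.
- exact: inball.
have h00 : h != 0 by rewrite gt_eqF.
apply: (mulIf h00); apply: (mulIf h00).
rewrite (addrCA (h *: e j)) in E2.
have sw4 (a b c0 d0 : R) : a - b - (c0 - d0) = a - c0 - (b - d0) by ring.
by apply: (etrans (esym E2)); apply: (etrans _ E1); exact: sw4.
Qed.

End calculus.

(** * Test functions *)

Section test_functions.
Context {R : realType} {n : nat}.
Implicit Types (f g : 'rV[R]_n -> R) (x : 'rV[R]_n) (U V O K : set 'rV[R]_n).
Local Notation e i := (delta_mx ord0 i : 'rV[R]_n).

Lemma closed_compact_rV K : compact K -> closed K.
Proof. by apply: compact_closed; exact: norm_hausdorff. Qed.

Lemma tsupp_out f x : ~ tsupp f x -> \near x, f x = 0.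
Proof.
move=> nx; have : nbhs x (~` tsupp f).
  by apply: open_nbhs_nbhs; split => //; exact: closed_openC (@closed_closure _ _).
apply: filterS => y ny; apply/eqP; apply: contra_notT ny => fy.
exact: subset_closure.
Qed.

Lemma tsupp_out0 f x : ~ tsupp f x -> f x = 0.
Proof. by move/tsupp_out/nbhs_singleton. Qed.

(** Smoothness on a neighbourhood U of K is enough, since f vanishes on the
    complement of K, which together with U covers the space. *)
Lemma test_intro O U K f : open U -> compact K -> K `<=` O -> K `<=` U ->
  smoothOn U f -> (forall x, ~ K x -> f x = 0) -> test_function O f.
Proof.
move=> oU cK KO KU sf f0; have clK := closed_compact_rV cK.
have tK : tsupp f `<=` K.
  rewrite /tsupp (_ : K = closure K); last exact/closure_id.
  apply: closure_subset => x /= /eqP fx.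
  by apply: contrapT => /f0.
split; last exact: subset_trans KO.
  move=> m; apply/CkOnT; rewrite (_ : setT = U `|` ~` K).
    apply: CkOnU => //; apply: (@CkOn_eq _ _ _ _ (fun=> 0)); last exact: CkOn_cst.
      exact: closed_openC.
    by move=> x /= /f0.
  apply/esym; rewrite -subTset => x _ /=.
  by have [/KU|] := pselect (K x); [left|right].
exact: subclosed_compact (@closed_closure _ _) cK tK.
Qed.

Lemma test_smooth O f : test_function O f -> smooth f.
Proof. by case. Qed.

Lemma test_smoothOn O f U : test_function O f -> smoothOn U f.
Proof. by move=> [sf _ _] m; apply: CkOn_sub ((CkOnT _ _).2 (sf m)). Qed.

Lemma test_out O f x : test_function O f -> ~ O x -> \near x, f x = 0.
Proof. by move=> [_ _ fO] nx; apply: tsupp_out => /fO. Qed.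

Lemma test_out0 O f x : test_function O f -> ~ O x -> f x = 0.
Proof. by move=> tf /(test_out tf)/nbhs_singleton. Qed.

Lemma test_bsupp O f : test_function O f -> bsupp f.
Proof.
move=> [_ /compact_bounded [M [Mr hM]] _]; exists (M + 1) => x nx.
apply: tsupp_out0 => tx; apply: nx => i.
have /(_ _ tx) /= : globally (tsupp f) [set x0 | `|x0| <= M + 1].
  by apply: hM; rewrite ltrDl.
apply: le_trans; rewrite [leRHS]/Num.norm /= mx_normrE.
by apply/bigmax_geP; right => /=; exists (ord0, i).
Qed.

Lemma test_cst0 O : test_function O (fun=> 0).
Proof.
apply: (@test_intro _ setT set0) => //.
- exact: openT.
- exact: compact0.
- by move=> m; exact: CkOn_cst.
Qed.

Lemma testD O f g : test_function O f -> test_function O g ->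
  test_function O (fun x => f x + g x).
Proof.
move=> tf tg; have [[_ cf fO] [_ cg gO]] := (tf, tg).
apply: (@test_intro _ setT (tsupp f `|` tsupp g)) => //.
- exact: openT.
- exact: compactU.
- by move=> x [/fO|/gO].
- by move=> m; apply: CkOnD; [exact: openT|exact: test_smoothOn tf _|exact: test_smoothOn tg _].
- by move=> x /not_orP[nf ng]; rewrite !tsupp_out0 ?addr0.
Qed.

Lemma testMr O U f g : open U -> O `<=` U -> test_function O f -> smoothOn U g ->
  test_function O (fun x => f x * g x).
Proof.
move=> oU OU tf sg; have [_ cf fO] := tf.
apply: (@test_intro _ U (tsupp f)) => //.
- exact: subset_trans OU.
- by move=> m; apply: CkOnM => //; exact: test_smoothOn tf _.
- by move=> x nf; rewrite tsupp_out0 ?mul0r.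
Qed.

Lemma testMl O g f : smooth g -> test_function O f ->
  test_function O (fun x => g x * f x).
Proof.
move=> sg tf; rewrite (_ : (fun _ => _) = fun x => f x * g x).
  by apply: (@testMr _ setT) => //; [exact: openT|exact/smoothOnT].
by apply/funext => x; rewrite mulrC.
Qed.

Lemma testM O f g : test_function O f -> test_function O g ->
  test_function O (fun x => f x * g x).
Proof. by move=> /test_smooth; exact: testMl. Qed.

Lemma smooth_cst (a : R) : smooth (fun _ : 'rV[R]_n => a).
Proof. by apply/smoothOnT => m; exact: CkOn_cst. Qed.

Lemma smooth_coord i : smooth (fun x : 'rV[R]_n => x ord0 i).
Proof. by apply/smoothOnT => m; exact: CkOn_coord. Qed.

Lemma smoothD f g : smooth f -> smooth g -> smooth (fun x => f x + g x).
Proof. by move=> sf sg m; apply/CkOnT; apply: CkOnD; [exact: openT|exact/CkOnT|exact/CkOnT]. Qed.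

Lemma smoothM f g : smooth f -> smooth g -> smooth (fun x => f x * g x).
Proof. by move=> sf sg m; apply/CkOnT; apply: CkOnM; [exact: openT|exact/CkOnT|exact/CkOnT]. Qed.

Lemma smooth_sum (I : Type) (s : seq I) (F : I -> 'rV[R]_n -> R) :
  (forall k, smooth (F k)) -> smooth (fun x => \sum_(k <- s) F k x).
Proof.
by move=> sF m; apply/CkOnT; apply: CkOn_sum => [|k]; [exact: openT|exact/CkOnT/sF].
Qed.

Lemma smooth_partial f i : smooth f -> smooth (partial i f).
Proof. by move=> /smoothOnT sf; apply/smoothOnT; exact: smoothOn_partial. Qed.

Lemma smooth_derivable f x i : smooth f -> derivable f x (e i).
Proof. by move=> /smoothOnT sf; exact: smoothOn_derivable sf x i I. Qed.

Lemma smooth_cont f : smooth f -> continuous f.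
Proof. by move=> /(_ 0%N)[]. Qed.

Lemma testZ O (a : R) f : test_function O f -> test_function O (fun x => a * f x).
Proof. by apply: testMl; exact: smooth_cst. Qed.

Lemma testN O f : test_function O f -> test_function O (fun x => - f x).
Proof.
move=> /(testZ (-1)) tf; rewrite (_ : (fun _ => _) = fun x => -1 * f x) //.
by apply/funext => x; rewrite mulN1r.
Qed.

Lemma testB O f g : test_function O f -> test_function O g ->
  test_function O (fun x => f x - g x).
Proof. by move=> tf /testN; exact: testD. Qed.

Lemma test_sum O (I : Type) (s : seq I) (F : I -> 'rV[R]_n -> R) :
  (forall k, test_function O (F k)) -> test_function O (fun x => \sum_(k <- s) F k x).
Proof.
move=> tF; elim: s => [|k s IH].
  rewrite (_ : (fun _ => _) = fun=> 0); first exact: test_cst0.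
  by apply/funext => y; rewrite big_nil.
rewrite (_ : (fun _ => _) = fun y => F k y + \sum_(k <- s) F k y).
  exact: testD.
by apply/funext => y; rewrite big_cons.
Qed.

Lemma test_partial O f i : test_function O f -> test_function O (partial i f).
Proof.
move=> tf; have [sf cf fO] := tf; apply: (@test_intro _ setT (tsupp f)) => //.
- exact: openT.
- exact/smoothOnT/smooth_partial.
- by move=> x nf; apply: derive_near0; exact: tsupp_out.
Qed.

(** Outside O the first factor vanishes identically near x, so that both sides
    are 0 whatever the behaviour of g there. *)
Lemma partialMr O U f g x i : O `<=` U -> test_function O f -> smoothOn U g ->
  partial i (fun y => f y * g y) x = partial i f x * g x + f x * partial i g x.
Proof.
move=> OU tf sg; have [Ox|nOx] := pselect (O x).
  apply: partialM; first exact/smooth_derivable/(test_smooth tf).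
  exact: smoothOn_derivable sg _ _ (OU _ Ox).
have f0 := test_out tf nOx.
rewrite (nbhs_singleton f0) mul0r addr0 (_ : partial i f x = 0) ?mul0r; last first.
  exact: derive_near0.
by apply: derive_near0; apply: filterS f0 => y ->; rewrite mul0r.
Qed.

End test_functions.

(** * Dilations, rotations and the spherical Laplacian *)

Section operators.
Context {R : realType} {n : nat}.
Implicit Types (f g : 'rV[R]_n -> R) (x : 'rV[R]_n) (U V O K : set 'rV[R]_n).
Local Notation e i := (delta_mx ord0 i : 'rV[R]_n).

Definition sqn x : R := \sum_(i < n) x ord0 i ^+ 2.

(** The derivative d/dt for t = log |x|. *)
Definition euler f x : R := \sum_(i < n) x ord0 i * partial i f x.

Definition rot (i j : 'I_n) f x : R :=
  x ord0 i * partial j f x - x ord0 j * partial i f x.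

(** The Laplacian of the spheres centred at 0, as the Casimir sum of the squared
    rotation fields. Every pair of coordinates is counted twice, hence 1/2. *)
Definition sph f x : R := 2^-1 * \sum_(i < n) \sum_(j < n) rot i j (rot i j f) x.

Lemma partial_coord k i x : partial k (fun y => y ord0 i) x = (k == i)%:R.
Proof. exact: (@derive_val _ _ _ _ _ _ _ (is_derive_coord _ _ _)). Qed.

Lemma derivable_coord k i x : derivable (fun y : 'rV[R]_n => y ord0 i) x (e k).
Proof. exact: (@ex_derive _ _ _ _ _ _ _ (is_derive_coord _ _ _)). Qed.

Lemma partial_coordM f k l x : smooth f ->
  partial k (fun y => y ord0 l * f y) x = (k == l)%:R * f x + x ord0 l * partial k f x.
Proof.
move=> sf; rewrite partialM ?partial_coord //; first exact: derivable_coord.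
exact: smooth_derivable.
Qed.

Lemma smooth_euler f : smooth f -> smooth (euler f).
Proof.
by move=> sf; apply: smooth_sum => i; apply: smoothM; [exact: smooth_coord|exact: smooth_partial].
Qed.

Lemma smoothN f : smooth f -> smooth (fun x => - f x).
Proof.
move=> sf; rewrite (_ : (fun _ => _) = fun x => -1 * f x).
  by apply: smoothM => //; exact: smooth_cst.
by apply/funext => x; rewrite mulN1r.
Qed.

Lemma smooth_rot i j f : smooth f -> smooth (rot i j f).
Proof.
move=> sf; apply: smoothD; last apply: smoothN;
  by apply: smoothM; [exact: smooth_coord|exact: smooth_partial].
Qed.

Lemma smooth_sph f : smooth f -> smooth (sph f).
Proof.
move=> sf; apply: smoothM; first exact: smooth_cst.
by apply: smooth_sum => i; apply: smooth_sum => j; do 2 apply: smooth_rot.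
Qed.

Lemma test_euler O f : test_function O f -> test_function O (euler f).
Proof.
by move=> tf; apply: test_sum => i; apply: testMl; [exact: smooth_coord|exact: test_partial].
Qed.

Lemma test_rot O i j f : test_function O f -> test_function O (rot i j f).
Proof.
move=> tf; apply: testB; by apply: testMl; [exact: smooth_coord|exact: test_partial].
Qed.

Lemma test_sph O f : test_function O f -> test_function O (sph f).
Proof.
move=> sf; apply: testZ.
by apply: test_sum => i; apply: test_sum => j; do 2 apply: test_rot.
Qed.

Lemma test_laplacian O f : test_function O f -> test_function O (laplacian f).
Proof. by move=> sf; apply: test_sum => i; do 2 apply: test_partial. Qed.

Lemma partial_euler f k x : smooth f ->
  partial k (euler f) x = partial k f x +
    \sum_(l < n) x ord0 l * partial k (partial l f) x.
Proof.
move=> sf.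
have dF l : derivable (fun y : 'rV[R]_n => y ord0 l * partial l f y) x (e k).
  by apply: derivableM; [exact: derivable_coord|exact/smooth_derivable/smooth_partial].
rewrite (partial_sum _ dF).2.
transitivity (\sum_l ((k == l)%:R * partial l f x + x ord0 l * partial k (partial l f) x)).
  by apply: eq_bigr => l _; rewrite partial_coordM //; exact: smooth_partial.
rewrite big_split /=; congr (_ + _).
rewrite (bigD1 k) //= eqxx mul1r big1 ?addr0 // => l lk.
by rewrite eq_sym (negbTE lk) mul0r.
Qed.

Lemma partial_rot f i j k x : smooth f ->
  partial k (rot i j f) x = (k == i)%:R * partial j f x
      + x ord0 i * partial k (partial j f) x
   - ((k == j)%:R * partial i f x + x ord0 j * partial k (partial i f) x).
Proof.
move=> sf.
have dF p q : derivable (fun y : 'rV[R]_n => y ord0 p * partial q f y) x (e k).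
  by apply: derivableM; [exact: derivable_coord|exact/smooth_derivable/smooth_partial].
rewrite /rot partialD; [|exact: dF|exact: derivableN].
rewrite partialN //.
by rewrite !partial_coordM //; exact: smooth_partial.
Qed.

Lemma sum_delta (F : 'I_n -> R) i : \sum_(k < n) (k == i)%:R * F k = F i.
Proof.
rewrite (bigD1 i) //= eqxx mul1r big1 ?addr0 // => k ki.
by rewrite (negbTE ki) mul0r.
Qed.

(** The computation behind [euler_rotC]: a, d and h stand for the coordinates,
    the gradient and the Hessian at a point. *)
Lemma rot_euler_sum (a d : 'I_n -> R) (h : 'I_n -> 'I_n -> R) i j :
  (forall i j, h i j = h j i) ->
  \sum_k a k * ((k == i)%:R * d j + a i * h k j - ((k == j)%:R * d i + a j * h k i))
  = a i * (d j + \sum_l a l * h j l) - a j * (d i + \sum_l a l * h i l).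
Proof.
move=> hC.
transitivity (\sum_k ((k == i)%:R * (a k * d j) + a i * (a k * h j k)
                   - ((k == j)%:R * (a k * d i)) - a j * (a k * h i k))).
  by apply: eq_bigr => k _; rewrite (hC k j) (hC k i); ring.
rewrite !big_split /= !sumrN !sum_delta -!mulr_sumr.
ring.
Qed.

(** Dilations commute with rotations. *)
Lemma euler_rotC f i j x : smooth f -> euler (rot i j f) x = rot i j (euler f) x.
Proof.
move=> sf; rewrite [RHS]/rot !partial_euler //.
rewrite -(@rot_euler_sum (fun i => x ord0 i) (fun i => partial i f x)
  (fun i j => partial i (partial j f) x)); last first.
  by move=> k l; apply: partialC; exact: sf.
by apply: eq_bigr => k _; rewrite partial_rot.
Qed.

(** The computation behind [sphE], with the notation of [rot_euler_sum]. *)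
Lemma rot_sq_sum (a d : 'I_n -> R) (h : 'I_n -> 'I_n -> R) : (forall i j, h i j = h j i) ->
  2^-1 * \sum_(i < n) \sum_(j < n)
    (a i * ((j == i)%:R * d j + a i * h j j - (1 * d i + a j * h j i))
     - a j * (1 * d j + a i * h i j - ((i == j)%:R * d i + a j * h i i)))
  = (\sum_i a i ^+ 2) * \sum_i h i i - (n%:R - 2) * (\sum_i a i * d i)
    - \sum_k a k * (d k + \sum_l a l * h k l).
Proof.
move=> hC; set Q := \sum_i a i ^+ 2; set H := \sum_i h i i; set D := \sum_i a i * d i.
pose G i := \sum_l a l * h i l.
transitivity (2^-1 * \sum_i (2 * (a i * d i) + H * a i ^+ 2 - n%:R * (a i * d i)
  - D - 2 * (a i * G i) + Q * h i i)).
  congr (_ * _); apply: eq_bigr => i _.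
  transitivity (\sum_j ((j == i)%:R * (a i * d j) + a i ^+ 2 * h j j - a i * d i
     - (2 * a i) * (a j * h i j) - a j * d j + (j == i)%:R * (a j * d i) + h i i * a j ^+ 2)).
    by apply: eq_bigr => j _; rewrite (hC j i) (eq_sym i j); ring.
  rewrite !big_split /= !sumrN !sum_delta -!mulr_sumr sumr_const card_ord -/H -/D -/Q -/(G i).
  by rewrite -mulr_natl; ring.
have -> : \sum_k a k * (d k + \sum_l a l * h k l) = D + \sum_k a k * G k.
  by rewrite -big_split /=; apply: eq_bigr => k _; rewrite mulrDr.
rewrite !big_split /= !sumrN -!mulr_sumr sumr_const card_ord -/H -/D -/Q -mulr_natl.
by field.
Qed.

(** This is the Laplacian in polar coordinates, |x|^2 Delta = E^2 + (n - 2) E + S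
    with E = [euler] and S = [sph], stated without charts of the sphere. *)
Lemma sphE f x : smooth f ->
  sph f x = sqn x * laplacian f x - (n%:R - 2) * euler f x - euler (euler f) x.
Proof.
move=> sf; rewrite [euler (euler f) x]/euler.
under [X in _ = _ - X]eq_bigr do rewrite partial_euler //.
rewrite -(@rot_sq_sum (fun i => x ord0 i) (fun i => partial i f x)
  (fun i j => partial i (partial j f) x)); last first.
  by move=> i j; apply: partialC; exact: sf.
congr (_ * _); apply: eq_bigr => i _; apply: eq_bigr => j _.
by rewrite /rot -/(rot i j f) !partial_rot // !eqxx.
Qed.

End operators.

(** * Leibniz rules and logarithmic weights *)

Section leibniz.
Context {R : realType} {n : nat}.
Implicit Types (f g h : 'rV[R]_n -> R) (x : 'rV[R]_n) (U V O K : set 'rV[R]_n).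
Local Notation e i := (delta_mx ord0 i : 'rV[R]_n).

Lemma euler_sum (I : Type) (s : seq I) (F : I -> 'rV[R]_n -> R) x :
  (forall k, smooth (F k)) ->
  euler (fun y => \sum_(k <- s) F k y) x = \sum_(k <- s) euler (F k) x.
Proof.
move=> sF; rewrite /euler exchange_big /=; apply: eq_bigr => i _.
by rewrite (partial_sum _ (fun k => smooth_derivable (sF k))).2 mulr_sumr.
Qed.

Lemma eulerZ a f x : smooth f -> euler (fun y => a * f y) x = a * euler f x.
Proof.
move=> sf; rewrite /euler mulr_sumr; apply: eq_bigr => i _.
by rewrite partialZ; [rewrite mulrCA|exact: smooth_derivable].
Qed.

Lemma eulerD f g x : smooth f -> smooth g ->
  euler (fun y => f y + g y) x = euler f x + euler g x.
Proof.
move=> sf sg; rewrite /euler -big_split; apply: eq_bigr => i _ /=.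
by rewrite partialD ?mulrDr //; exact: smooth_derivable.
Qed.

Lemma rotZ i j a f x : smooth f -> rot i j (fun y => a * f y) x = a * rot i j f x.
Proof.
move=> sf; rewrite /rot !partialZ; [ring|exact: smooth_derivable|exact: smooth_derivable].
Qed.

Lemma rotD i j f g x : smooth f -> smooth g ->
  rot i j (fun y => f y + g y) x = rot i j f x + rot i j g x.
Proof.
move=> sf sg; rewrite /rot !partialD; first ring; exact: smooth_derivable.
Qed.

Lemma sphZ a f x : smooth f -> sph (fun y => a * f y) x = a * sph f x.
Proof.
move=> sf; rewrite /sph mulrCA; congr (_ * _); rewrite mulr_sumr; apply: eq_bigr => i _.
rewrite mulr_sumr; apply: eq_bigr => j _.
rewrite (_ : rot i j (fun y => a * f y) = fun y => a * rot i j f y).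
  by rewrite rotZ //; exact: smooth_rot.
by apply/funext => y; rewrite rotZ.
Qed.

Lemma sphD f g x : smooth f -> smooth g ->
  sph (fun y => f y + g y) x = sph f x + sph g x.
Proof.
move=> sf sg; rewrite /sph -mulrDr; congr (_ * _); rewrite -big_split.
apply: eq_bigr => i _; rewrite -big_split; apply: eq_bigr => j _ /=.
rewrite (_ : rot i j (fun y => f y + g y) = fun y => rot i j f y + rot i j g y).
  by rewrite rotD //; exact: smooth_rot.
by apply/funext => y; rewrite rotD.
Qed.

Lemma sph0 x : sph (fun=> 0 : R) x = 0.
Proof.
by have := @sphZ 0 (fun=> 0) x (smooth_cst _); rewrite !mul0r.
Qed.

Lemma sph_sum (I : Type) (s : seq I) (F : I -> 'rV[R]_n -> R) x :
  (forall k, smooth (F k)) ->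
  sph (fun y => \sum_(k <- s) F k y) x = \sum_(k <- s) sph (F k) x.
Proof.
move=> sF; elim: s => [|k s IH].
  rewrite big_nil (_ : (fun _ => _) = fun=> 0) ?sph0 //.
  by apply/funext => y; rewrite big_nil.
rewrite (_ : (fun y => _) = fun y => F k y + (fun z => \sum_(k <- s) F k z) y); last first.
  by apply/funext => y; rewrite big_cons.
rewrite (sphD _ (sF k) (smooth_sum s sF)) IH.
by rewrite [RHS]big_cons.
Qed.

Lemma euler_sphC f x : smooth f -> euler (sph f) x = sph (euler f) x.
Proof.
move=> sf; rewrite /sph eulerZ; last first.
  by apply: smooth_sum => i; apply: smooth_sum => j; do 2 apply: smooth_rot.
congr (_ * _); rewrite euler_sum; last first.
  by move=> i; apply: smooth_sum => j; do 2 apply: smooth_rot.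
apply: eq_bigr => i _; rewrite euler_sum; last by move=> j; do 2 apply: smooth_rot.
apply: eq_bigr => j _; rewrite euler_rotC; last exact: smooth_rot.
by congr (rot i j _ x); apply/funext => y; exact: euler_rotC.
Qed.

(** The product rule is kept as a hypothesis in what follows, because it holds
    for different reasons for smooth functions, for a test function times a
    weight that is smooth on its support, and for a C^1 cutoff. *)
Definition leibniz f g := forall i x,
  partial i (fun y => f y * g y) x = partial i f x * g x + f x * partial i g x.

Lemma leibniz_smooth f g : smooth f -> smooth g -> leibniz f g.
Proof. by move=> sf sg i x; apply: partialM; exact: smooth_derivable. Qed.

Lemma leibniz_test O U f g : O `<=` U -> test_function O f -> smoothOn U g -> leibniz f g.
Proof. by move=> OU tf sg i x; exact: partialMr OU tf sg. Qed.

Lemma eulerM f g x : leibniz f g ->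
  euler (fun y => f y * g y) x = euler f x * g x + f x * euler g x.
Proof.
move=> fg; rewrite /euler mulr_suml mulr_sumr -big_split; apply: eq_bigr => i _ /=.
by rewrite fg; ring.
Qed.

Lemma rotM i j f g x : leibniz f g ->
  rot i j (fun y => f y * g y) x = rot i j f x * g x + f x * rot i j g x.
Proof. by move=> fg; rewrite /rot !fg; ring. Qed.

(** A radial factor g is killed by all rotation fields. The last two hypotheses
    allow g to be irregular where f vanishes. *)
Lemma sphMr f g : leibniz f g -> (forall i j, leibniz (rot i j f) g) ->
  (forall i j x, f x * rot i j g x = 0) ->
  (forall i j x, rot i j f x * rot i j g x = 0) ->
  sph (fun y => f y * g y) = fun y => sph f y * g y.
Proof.
move=> fg rfg fg0 rfg0; apply/funext => x; rewrite /sph -mulrA; congr (_ * _).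
rewrite mulr_suml; apply: eq_bigr => i _; rewrite mulr_suml; apply: eq_bigr => j _.
rewrite (_ : rot i j (fun y => f y * g y) = fun y => rot i j f y * g y).
  by rewrite rotM // rfg0 addr0.
by apply/funext => y; rewrite rotM // fg0 addr0.
Qed.

End leibniz.

Section weights.
Context {R : realType} {n : nat}.
Implicit Types (f g h : 'rV[R]_n -> R) (x : 'rV[R]_n) (U V O K : set 'rV[R]_n).
Local Notation e i := (delta_mx ord0 i : 'rV[R]_n).

Definition outside : set 'rV[R]_n := [set x | 1 < sqn x].

(** This is log |x|; the square root in |x| is avoided. *)
Definition tau x : R := ln (sqn x) / 2.

(** This is |x|^a (log |x|)^b, with real exponents. *)
Definition wt (a b : R) x : R := expR (a * tau x + b * ln (tau x)).

Lemma coord_sqE k : (fun y : 'rV[R]_n => y ord0 k ^+ 2) = fun y => y ord0 k * y ord0 k.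
Proof. by apply/funext => y; rewrite expr2. Qed.

Lemma smooth_coord_sq k : smooth (fun y : 'rV[R]_n => y ord0 k ^+ 2).
Proof. by rewrite coord_sqE; apply: smoothM; exact: smooth_coord. Qed.

Lemma smooth_sqn : smooth (@sqn R n).
Proof. by apply: smooth_sum => i; exact: smooth_coord_sq. Qed.

Lemma is_derive_sqn i x : is_derive x (e i) (@sqn R n) (2 * x ord0 i).
Proof.
have dF k : derivable (fun y : 'rV[R]_n => y ord0 k ^+ 2) x (e i).
  exact: smooth_derivable (smooth_coord_sq k).
have [ds Ds] := partial_sum (index_enum 'I_n) dF.
apply: DeriveDef; first exact: ds.
rewrite -[LHS]/(partial i (fun y : 'rV[R]_n => \sum_(k <- index_enum 'I_n) y ord0 k ^+ 2) x) Ds.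
transitivity (\sum_k (k == i)%:R * (2 * x ord0 k)); last exact: sum_delta.
apply: eq_bigr => k _.
rewrite coord_sqE partialM ?partial_coord; try exact: derivable_coord.
by rewrite eq_sym; ring.
Qed.

Lemma open_outside : open outside.
Proof.
rewrite (_ : outside = @sqn R n @^-1` [set r | 1 < r]) //.
by apply: open_comp; [move=> x _; exact: smooth_cont smooth_sqn x|exact: open_gt].
Qed.

Lemma sqn_gt0 x : outside x -> 0 < sqn x.
Proof. exact: lt_trans. Qed.

Lemma tau_gt0 x : outside x -> 0 < tau x.
Proof. by move=> ox; rewrite divr_gt0 // ln_gt0. Qed.

Lemma is_derive_tau i x : outside x -> is_derive x (e i) tau (x ord0 i / sqn x).
Proof.
move=> ox; have q0 := sqn_gt0 ox.
have H := is_derive_comp1 (is_derive1_ln q0) (is_derive_sqn i x).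
have : is_derive x (e i) (2^-1 *: (fun y => ln (@sqn R n y))) (2^-1 *: ((sqn x)^-1 * (2 * x ord0 i))).
  exact: is_deriveZ.
rewrite (_ : 2^-1 *: _ = tau); last by apply/funext => y; rewrite /tau mulrC.
move=> {}H; apply: is_derive_eq.
rewrite -[_ *: _]/(_ * _); field; exact: lt0r_neq0.
Qed.

Lemma wtM a b c d x : wt a b x * wt c d x = wt (a + c) (b + d) x.
Proof. by rewrite /wt -expRD; congr expR; ring. Qed.

Lemma wt00 x : wt 0 0 x = 1.
Proof. by rewrite /wt !mul0r addr0 expR0. Qed.

Lemma wt_gt0 a b x : 0 < wt a b x.
Proof. exact: expR_gt0. Qed.

Lemma wt_tau a b x : outside x -> wt a b x / tau x = wt a (b - 1) x.
Proof.
move=> ox; rewrite /wt (_ : a * _ + (b - 1) * _ = a * tau x + b * ln (tau x) - ln (tau x)); last by ring.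
by rewrite [in RHS]expRD expRN lnK // posrE tau_gt0.
Qed.

Lemma wt_sqn a b x : outside x -> wt a b x / sqn x = wt (a - 2) b x.
Proof.
move=> ox; rewrite /wt (_ : (a - 2) * _ + _ = a * tau x + b * ln (tau x) - 2 * tau x); last by ring.
rewrite [in RHS]expRD expRN; congr (_ / _).
by rewrite /tau mulrC divfK // lnK // posrE sqn_gt0.
Qed.

Lemma is_derive_wt a b i x : outside x ->
  is_derive x (e i) (wt a b)
   (x ord0 i * (a * wt (a - 2) b x + b * wt (a - 2) (b - 1) x)).
Proof.
move=> ox; have t0 := tau_gt0 ox; have q0 := sqn_gt0 ox.
have dt := is_derive_tau i ox.
have dl := is_derive_comp1 (is_derive1_ln t0) dt.
have ds : is_derive x (e i) ((a *: tau) + (b *: (fun y => ln (tau y))))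
   (a *: (x ord0 i / sqn x) + b *: ((tau x)^-1 * (x ord0 i / sqn x))).
  by apply: is_deriveD; exact: is_deriveZ.
have H := is_derive_comp1 (is_derive_expR _) ds.
rewrite -(wt_sqn _ _ ox) -(wt_sqn a (b - 1) ox) -(wt_tau _ _ ox).
move: H; rewrite -/(wt a b) => H; apply: is_derive_eq.
rewrite (_ : expR _ = wt a b x) // -[a *: _]/(a * _) -[b *: _]/(b * _).
field; rewrite !lt0r_neq0 //.
Qed.

(** The partial derivatives of a weight are combinations of weights times a
    coordinate, which makes an induction on the order possible. *)
Lemma smooth_wt a b : smoothOn outside (wt a b).
Proof.
have cw a' b' x : outside x -> {for x, continuous (wt a' b')}.
  move=> ox.
  have cs : {for x, continuous (@sqn R n)} by exact: smooth_cont smooth_sqn x.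
  have cl : {for x, continuous (fun y => ln (@sqn R n y))}.
    by apply: continuous_comp => //; apply: continuous_ln; exact: sqn_gt0.
  have ct : {for x, continuous tau}.
    by apply: continuousM => //; exact: cst_continuous.
  have clt : {for x, continuous (fun y => ln (tau y))}.
    by apply: continuous_comp => //; apply: continuous_ln; exact: tau_gt0.
  apply: (@continuous_comp _ _ _ (fun y => a' * tau y + b' * ln (tau y)) expR).
    by apply: continuousD; apply: continuousM => //; exact: cst_continuous.
  exact: continuous_expR.
move=> m; elim: m a b => [|m IH] a b; split => //; try by move=> x /cw; exact.
move=> i; split => [x ox|].
  exact: (@ex_derive _ _ _ _ _ _ _ (is_derive_wt a b i ox)).
apply: (@CkOn_eq _ _ _ _ (fun x => x ord0 i * (a * wt (a - 2) b x + b * wt (a - 2) (b - 1) x))).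
- exact: open_outside.
- by move=> x ox; rewrite -(@derive_val _ _ _ _ _ _ _ (is_derive_wt a b i ox)).
- have oO := open_outside.
  apply: CkOnM => //; first exact: CkOn_coord.
  by apply: CkOnD => //; apply: CkOnM => //; first [exact: CkOn_cst|exact: IH].
Qed.

Lemma partial_wt a b i x : outside x ->
  partial i (wt a b) x = x ord0 i * (a * wt (a - 2) b x + b * wt (a - 2) (b - 1) x).
Proof. by move=> ox; exact: (@derive_val _ _ _ _ _ _ _ (is_derive_wt a b i ox)). Qed.

Lemma rot_wt a b i j x : outside x -> rot i j (wt a b) x = 0.
Proof. by move=> ox; rewrite /rot !partial_wt //; ring. Qed.

Lemma euler_wt a b x : outside x -> euler (wt a b) x = a * wt a b x + b * wt a (b - 1) x.
Proof.
move=> ox; rewrite /euler.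
under eq_bigr do rewrite partial_wt // mulrA -expr2.
rewrite -mulr_suml -/(sqn x) -!(wt_sqn _ _ ox).
field; exact/lt0r_neq0/sqn_gt0.
Qed.

Lemma tau_enorm x : outside x -> ln (enorm x) = tau x.
Proof.
move=> ox; have e0 : 0 < enorm x by rewrite sqrtr_gt0 sqn_gt0.
rewrite /tau (_ : sqn x = enorm x ^+ 2).
  by rewrite lnXn // -[_ *+ 2]mulr_natr mulfK ?pnatr_eq0.
by rewrite sqr_sqrtr // ltW // sqn_gt0.
Qed.

Lemma wt_ln a b x : outside x -> 
  wt a b x = expR (a * ln (enorm x)) * expR (b * ln (ln (enorm x))).
Proof.
by move=> ox; rewrite -expRD tau_enorm.
Qed.

End weights.

(** * Integration by parts along rotations *)

Section integral.
Context {R : realType} {n : nat}.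
Implicit Types (f g h : 'rV[R]_n -> R) (x : 'rV[R]_n) (U V O K : set 'rV[R]_n).
Local Notation e i := (delta_mx ord0 i : 'rV[R]_n).

Definition Int f : R := \int[lebesgue_rV R n]_x f x.

Definition cc f := continuous f /\ bsupp f.

Lemma cc_integrable f : cc f -> (lebesgue_rV R n).-integrable setT (EFin \o f).
Proof. by case; exact: integrable_rV. Qed.

Lemma EFin_Int f : cc f -> (\int[lebesgue_rV R n]_x (f x)%:E)%E = (Int f)%:E.
Proof.
move=> /cc_integrable fi; rewrite /Int /Rintegral fineK //.
exact: integrable_fin_num.
Qed.

Lemma bsuppD f g : bsupp f -> bsupp g -> bsupp (fun x => f x + g x).
Proof.
move=> [S fS] [T gT]; exists (Num.max S T) => x nx.
rewrite fS ?gT ?addr0 // => cx; apply: nx => i;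
  by rewrite (le_trans (cx i)) // le_max lexx ?orbT.
Qed.

Lemma bsuppM f g : bsupp f -> bsupp (fun x => f x * g x).
Proof. by move=> [S fS]; exists S => x nx; rewrite fS ?mul0r. Qed.

Lemma ccD f g : cc f -> cc g -> cc (fun x => f x + g x).
Proof.
move=> [cf bf] [cg bg]; split; last exact: bsuppD.
by move=> x; apply: continuousD; [exact: cf|exact: cg].
Qed.

Lemma ccMr f g : cc f -> continuous g -> cc (fun x => f x * g x).
Proof.
move=> [cf bf] cg; split; last exact: bsuppM.
by move=> x; apply: continuousM; [exact: cf|exact: cg].
Qed.

Lemma ccM f g : cc f -> cc g -> cc (fun x => f x * g x).
Proof. by move=> cf [cg _]; exact: ccMr. Qed.

Lemma ccZ a f : cc f -> cc (fun x => a * f x).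
Proof.
move=> cf; rewrite (_ : (fun x => a * f x) = fun x => f x * a).
  by apply: ccMr => // x; exact: cst_continuous.
by apply/funext => x; rewrite mulrC.
Qed.

Lemma cc0 : cc (fun=> 0).
Proof. by split; [move=> x; exact: cst_continuous|exists 0]. Qed.

Lemma cc_sum (I : Type) (s : seq I) (F : I -> 'rV[R]_n -> R) :
  (forall k, cc (F k)) -> cc (fun x => \sum_(k <- s) F k x).
Proof.
move=> tF; elim: s => [|k s IH].
  rewrite (_ : (fun _ => _) = fun=> 0); first exact: cc0.
  by apply/funext => y; rewrite big_nil.
rewrite (_ : (fun _ => _) = fun y => F k y + \sum_(k <- s) F k y); first exact: ccD.
by apply/funext => y; rewrite big_cons.
Qed.

Lemma IntD f g : cc f -> cc g -> Int (fun x => f x + g x) = Int f + Int g.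
Proof. by move=> /cc_integrable fi /cc_integrable gi; rewrite /Int RintegralD. Qed.

Lemma IntZ a f : cc f -> Int (fun x => a * f x) = a * Int f.
Proof. by move=> /cc_integrable fi; rewrite /Int RintegralZl. Qed.

Lemma IntB f g : cc f -> cc g -> Int (fun x => f x - g x) = Int f - Int g.
Proof. by move=> /cc_integrable fi /cc_integrable gi; rewrite /Int RintegralB. Qed.

Lemma Int0 : Int (fun=> 0) = 0.
Proof. by have := IntZ 0 cc0; rewrite !mul0r. Qed.

Lemma Int_sum (I : Type) (s : seq I) (F : I -> 'rV[R]_n -> R) :
  (forall k, cc (F k)) -> Int (fun x => \sum_(k <- s) F k x) = \sum_(k <- s) Int (F k).
Proof.
move=> tF; elim: s => [|k s IH].
  rewrite big_nil (_ : (fun _ => _) = fun=> 0) ?Int0 //.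
  by apply/funext => y; rewrite big_nil.
rewrite (_ : (fun _ => _) = fun y => F k y + \sum_(k <- s) F k y); last first.
  by apply/funext => y; rewrite big_cons.
by rewrite IntD ?IH ?big_cons //; exact: cc_sum.
Qed.

Lemma Int_ge0 f : (forall x, 0 <= f x) -> 0 <= Int f.
Proof. by move=> f0; apply: Rintegral_ge0 => x _; exact: f0. Qed.

Lemma Int_le f g : cc f -> cc g -> (forall x, f x <= g x) -> Int f <= Int g.
Proof.
move=> /cc_integrable fi /cc_integrable gi fg.
by apply: le_Rintegral => // x _; exact: fg.
Qed.

Definition c1c f := Ck 1 f /\ bsupp f.

Lemma c1c_cc f : c1c f -> cc f.
Proof. by move=> [[cf _] bf]. Qed.

Lemma c1c_partial i f : c1c f -> cc (partial i f).
Proof. by move=> [[_ /(_ i) [_ [cf _]]] bf]; split => //; exact: bsupp_partial. Qed.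

Lemma test_c1c O f : test_function O f -> c1c f.
Proof. by move=> tf; split; [exact: test_smooth tf _|exact: test_bsupp tf]. Qed.

Lemma test_cc O f : test_function O f -> cc f.
Proof. by move=> /test_c1c; exact: c1c_cc. Qed.

Lemma Ck1M f g : Ck 1 f -> Ck 1 g -> Ck 1 (fun x => f x * g x).
Proof. by move=> /CkOnT cf /CkOnT cg; apply/CkOnT/CkOnM => //; exact: openT. Qed.

Lemma Ck1_derivable f x i : Ck 1 f -> derivable f x (e i).
Proof. by move=> [_ /(_ i) [+ _]]; exact. Qed.

Lemma c1cM f g : c1c f -> c1c g -> c1c (fun x => f x * g x).
Proof. by move=> [cf bf] [cg bg]; split; [exact: Ck1M|exact: bsuppM]. Qed.

Lemma c1c_leibniz f g : c1c f -> c1c g -> leibniz f g.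
Proof.
by move=> [cf _] [cg _] i x; apply: partialM; exact: Ck1_derivable.
Qed.

Lemma Int_partial i f : c1c f -> Int (partial i f) = 0.
Proof.
move=> [[cf h] bf]; have [df [cpf _]] := h i.
by rewrite /Int /Rintegral integral_partial.
Qed.

Lemma c1c_coordM i f : c1c f -> c1c (fun x => x ord0 i * f x).
Proof.
move=> [cf bf]; split; first by apply: Ck1M => //; exact: smooth_coord.
rewrite (_ : (fun _ => _) = fun x => f x * x ord0 i); first exact: bsuppM.
by apply/funext => x; rewrite mulrC.
Qed.

Lemma partial_coordM1 f k l x : Ck 1 f ->
  partial k (fun y => y ord0 l * f y) x = (k == l)%:R * f x + x ord0 l * partial k f x.
Proof.
move=> cf; rewrite partialM ?partial_coord //; first exact: derivable_coord.
exact: Ck1_derivable.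
Qed.

Lemma cc_coordM i f : cc f -> cc (fun x => x ord0 i * f x).
Proof.
move=> cf; rewrite (_ : (fun _ => _) = fun x => f x * x ord0 i).
  by apply: ccMr => //; exact: coord_continuous.
by apply/funext => x; rewrite mulrC.
Qed.

Lemma cc_rot i j f : c1c f -> cc (rot i j f).
Proof.
move=> cf; rewrite (_ : rot i j f = fun x => x ord0 i * partial j f x + -1 * (x ord0 j * partial i f x)).
  by apply: ccD; last apply: ccZ; apply: cc_coordM; exact: c1c_partial.
by apply/funext => x; rewrite mulN1r.
Qed.

(** A rotation field is divergence free. *)
Lemma Int_rot i j f : c1c f -> Int (rot i j f) = 0.
Proof.
move=> cf; have [ci cj] := (c1c_coordM i cf, c1c_coordM j cf).
transitivity (Int (fun x => partial j (fun y => y ord0 i * f y) x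
                          - partial i (fun y => y ord0 j * f y) x)).
  congr Int; apply/funext => x; rewrite !partial_coordM1 ?cf.1 //; try exact: cf.1.
  by rewrite /rot eq_sym; ring.
by rewrite IntB ?Int_partial ?subrr //; exact: c1c_partial.
Qed.

Lemma Int_rot_anti i j f g : c1c f -> c1c g ->
  Int (fun x => rot i j f x * g x) = - Int (fun x => f x * rot i j g x).
Proof.
move=> cf cg; apply/eqP; rewrite -subr_eq0 opprK -IntD.
- rewrite -(Int_rot i j (c1cM cf cg)); apply/eqP; congr Int; apply/funext => x.
  by rewrite rotM //; exact: c1c_leibniz.
- by apply: ccM; [exact: cc_rot|exact: c1c_cc].
- by apply: ccM; [exact: c1c_cc|exact: cc_rot].
Qed.

(** The regularity that makes [sph] symmetric. It asks for second derivatives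
    along rotations only, and so applies to products with a radial C^1 cutoff. *)
Definition rc2 f := c1c f /\ forall i j, c1c (rot i j f).

Lemma test_rc2 O f : test_function O f -> rc2 f.
Proof.
by move=> tf; split => [|i j]; [exact: test_c1c tf|apply: (@test_c1c O); exact: test_rot].
Qed.

Lemma cc_sph f : rc2 f -> cc (sph f).
Proof.
move=> [_ cf]; apply: ccZ; apply: cc_sum => i; apply: cc_sum => j.
exact: cc_rot.
Qed.

Lemma Int_sph_grad f g : rc2 f -> c1c g ->
  Int (fun x => sph f x * g x) =
  - (2^-1 * \sum_i \sum_j Int (fun x => rot i j f x * rot i j g x)).
Proof.
move=> [cf rf] cg.
have ccr i j : cc (fun x => rot i j (rot i j f) x * g x).
  by apply: ccM; [exact: cc_rot|exact: c1c_cc].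
transitivity (Int (fun x => 2^-1 * \sum_i \sum_j (rot i j (rot i j f) x * g x))).
  congr Int; apply/funext => x; rewrite /sph -mulrA; congr (_ * _).
  by rewrite mulr_suml; apply: eq_bigr => i _; rewrite mulr_suml.
rewrite IntZ; last by apply: cc_sum => i; apply: cc_sum => j.
rewrite -mulrN; congr (_ * _).
rewrite Int_sum; last by move=> i; exact: cc_sum.
rewrite -sumrN; apply: eq_bigr => i _; rewrite Int_sum //.
rewrite -sumrN; apply: eq_bigr => j _.
exact: Int_rot_anti.
Qed.

Lemma Int_sphC f g : rc2 f -> rc2 g ->
  Int (fun x => sph f x * g x) = Int (fun x => f x * sph g x).
Proof.
move=> cf cg; rewrite (Int_sph_grad cf cg.1).
rewrite (_ : (fun x => f x * sph g x) = fun x => sph g x * f x); last first.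
  by apply/funext => x; rewrite mulrC.
rewrite (Int_sph_grad cg cf.1).
apply: (congr1 (fun z => - (2^-1 * z))); apply: eq_bigr => i _; apply: eq_bigr => j _.
congr Int.
by apply/funext => x; rewrite mulrC.
Qed.

End integral.

(** * Spherical components of polynomials *)

Section polynomials.
Context {R : realType} {n : nat}.
Implicit Types (f g p q : 'rV[R]_n -> R) (x : 'rV[R]_n).

(** Homogeneous polynomial functions of degree d, as an inductive predicate:
    the facts needed about them all follow by induction on their construction. *)
Inductive hpoly : nat -> ('rV[R]_n -> R) -> Prop :=
| hpoly0 d : hpoly d (fun=> 0)
| hpolyC a : hpoly 0 (fun=> a)
| hpolyX i d p : hpoly d p -> hpoly d.+1 (fun x => x ord0 i * p x)
| hpolyD d p q : hpoly d p -> hpoly d q -> hpoly d (fun x => p x + q x).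

Lemma hpoly_smooth d p : hpoly d p -> smooth p.
Proof.
elim=> {d p} [d|a|i d p _ sp|d p q _ sp _ sq].
- exact: smooth_cst.
- exact: smooth_cst.
- by apply: smoothM => //; exact: smooth_coord.
- exact: smoothD.
Qed.

Lemma hpolyZ d p a : hpoly d p -> hpoly d (fun x => a * p x).
Proof.
elim=> {d p} [d|b|i d p _ sp|d p q _ sp _ sq].
- by under eq_fun do rewrite mulr0; exact: hpoly0.
- exact: hpolyC.
- by under eq_fun do rewrite mulrCA; exact: hpolyX.
- by under eq_fun do rewrite mulrDr; exact: hpolyD.
Qed.

Lemma hpoly_sum d (I : Type) (s : seq I) (F : I -> 'rV[R]_n -> R) :
  (forall k, hpoly d (F k)) -> hpoly d (fun x => \sum_(k <- s) F k x).
Proof.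
move=> hF; elim: s => [|k s IH].
  by under eq_fun do rewrite big_nil; exact: hpoly0.
by under eq_fun do rewrite big_cons; exact: hpolyD.
Qed.

Lemma hpoly_partial d p i : hpoly d p ->
  if d is d'.+1 then hpoly d' (partial i p) else partial i p = fun=> 0.
Proof.
elim=> {d p} [d|a|k d p hp IH|d p q hp IHp hq IHq].
- have -> : partial i (fun=> 0) = fun=> 0 :> R by apply/funext => x; exact: partial_cst.
  by case: d => // d; exact: hpoly0.
- by apply/funext => x; exact: partial_cst.
- rewrite (_ : partial i _ = fun x => (i == k)%:R * p x + x ord0 k * partial i p x).
    apply: hpolyD; first exact: hpolyZ.
    case: d IH hp => [->|d IH] hp; last exact: hpolyX.
    by under eq_fun do rewrite mulr0; exact: hpoly0.
  by apply/funext => x; rewrite partial_coordM //; exact: hpoly_smooth hp.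
- rewrite (_ : partial i _ = fun x => partial i p x + partial i q x).
    case: d IHp IHq hp hq => [-> ->|d IHp IHq] _ _; last exact: hpolyD.
    by apply/funext => x; rewrite addr0.
  by apply/funext => x; rewrite partialD //; apply: smooth_derivable;
    first [exact: hpoly_smooth hp|exact: hpoly_smooth hq].
Qed.

Lemma hpoly_laplacian d p : hpoly d.+2 p -> hpoly d (laplacian p).
Proof. by move=> hp; apply: hpoly_sum => i; do 2 apply: (hpoly_partial i (d := _.+1)). Qed.

Lemma hpoly_laplacian_lt2 d p : (d < 2)%N -> hpoly d p -> laplacian p = fun=> 0.
Proof.
move=> d2 hp; apply/funext => x; rewrite /laplacian big1 // => i _.
case: d d2 hp => [|[|//]] _ hp.
  by rewrite (hpoly_partial i hp) partial_cst.
by have := hpoly_partial i (hpoly_partial i hp) => /= ->.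
Qed.

Lemma euler_hpoly d p : hpoly d p -> euler p = fun x => d%:R * p x.
Proof.
elim=> {d p} [d|a|k d p hp IH|d p q hp IHp hq IHq]; apply/funext => x.
- by rewrite mulr0 /euler big1 // => i _; rewrite partial_cst mulr0.
- by rewrite mul0r /euler big1 // => i _; rewrite partial_cst mulr0.
- rewrite eulerM; last by apply: leibniz_smooth; [exact: smooth_coord|exact: hpoly_smooth hp].
  rewrite IH (_ : euler _ x = x ord0 k); first by rewrite -natr1; ring.
  rewrite /euler; under eq_bigr do rewrite partial_coord mulrC.
  exact: (sum_delta (fun i => x ord0 i)).
- by rewrite eulerD ?IHp ?IHq; [ring|exact: hpoly_smooth hp|exact: hpoly_smooth hq].
Qed.

(** The eigenvalue of - S on the restrictions to spheres of harmonic polynomials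
    of degree d. *)
Definition sph_eig (d : nat) : R := d%:R * (d%:R + n%:R - 2).

Lemma sph_hpoly d p x : hpoly d p ->
  sph p x = sqn x * laplacian p x - sph_eig d * p x.
Proof.
move=> hp; rewrite sphE; last exact: hpoly_smooth hp.
rewrite (euler_hpoly hp) eulerZ ?(euler_hpoly hp) /sph_eig; first by ring.
exact: hpoly_smooth hp.
Qed.

Lemma rot_sqn i j x : rot i j (@sqn R n) x = 0.
Proof.
by rewrite /rot /partial !(@derive_val _ _ _ _ _ _ _ (is_derive_sqn _ _)); ring.
Qed.

Lemma sph_sqnM p : smooth p -> sph (fun x => p x * sqn x) = fun x => sph p x * sqn x.
Proof.
move=> sp; apply: sphMr.
- by apply: leibniz_smooth => //; exact: smooth_sqn.
- by move=> i j; apply: leibniz_smooth; [exact: smooth_rot|exact: smooth_sqn].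
- by move=> i j x; rewrite rot_sqn mulr0.
- by move=> i j x; rewrite rot_sqn mulr0.
Qed.

Definition eigsum N p := exists h : nat -> 'rV[R]_n -> R,
  [/\ forall j, smooth (h j), forall j x, sph (h j) x = - sph_eig j * h j x &
      forall x, p x = \sum_(0 <= j < N) h j x].

Lemma eigsum0 : eigsum 0 (fun=> 0).
Proof.
exists (fun _ _ => 0); split => [j|j x|x]; first exact: smooth_cst.
  by rewrite sph0 mulr0.
by rewrite big_nil.
Qed.

Lemma eigsum_le N M p : (N <= M)%N -> eigsum N p -> eigsum M p.
Proof.
move=> NM [h [hs he hp]]; exists (fun j => if (j < N)%N then h j else fun=> 0); split.
- by move=> j; case: ifP => // _; exact: smooth_cst.
- by move=> j x; case: ifP => // _; rewrite sph0 mulr0.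
- move=> x; rewrite hp [RHS](@big_cat_nat _ _ _ N) //=.
  rewrite [X in _ = _ + X](_ : _ = 0) ?addr0.
    by apply: eq_big_nat => j /andP[_ ->].
  by rewrite big_nat big1 // => j /andP[Nj _]; rewrite ltnNge Nj.
Qed.

Lemma eigsumD N p q : eigsum N p -> eigsum N q -> eigsum N (fun x => p x + q x).
Proof.
move=> [h [hs he hp]] [k [ks ke kq]]; exists (fun j x => h j x + k j x); split.
- by move=> j; exact: smoothD.
- by move=> j x; rewrite sphD // he ke mulrDr.
- by move=> x; rewrite big_split -hp -kq.
Qed.

Lemma eigsum_sqn N p : eigsum N p -> eigsum N (fun x => p x * sqn x).
Proof.
move=> [h [hs he hp]]; exists (fun j x => h j x * sqn x); split.
- by move=> j; apply: smoothM => //; exact: smooth_sqn.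
- by move=> j x; rewrite sph_sqnM // he mulrA.
- by move=> x; rewrite hp mulr_suml.
Qed.

Hypothesis n2 : (2 <= n)%N.

Lemma sph_eig_lt j d : (j < d)%N -> sph_eig j < sph_eig d.
Proof.
move=> jd; have nr : 2 <= n%:R :> R by rewrite ler_nat.
have j0 : 0 <= j%:R :> R by [].
have jdr : j%:R + 1 <= d%:R :> R by rewrite natr1 ler_nat.
rewrite /sph_eig; nra.
Qed.

(** The equation (S + sph_eig d) p = g is solved explicitly on the components of
    g, whose eigenvalues differ from that of degree d; the difference of p and
    this solution is annihilated by S + sph_eig d. *)
Lemma eigsum_step N d p g : (N <= d)%N -> smooth p -> eigsum N g ->
  (forall x, sph p x = g x - sph_eig d * p x) -> eigsum d.+1 p.
Proof.
move=> Nd sp [h [hs he hg]] pE.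
pose c j : R := (sph_eig d - sph_eig j)^-1.
pose k x := \sum_(0 <= j < N) c j * h j x.
have sk : smooth k.
  by apply: smooth_sum => j; apply: smoothM => //; exact: smooth_cst.
have ek : eigsum d.+1 k.
  apply: (@eigsum_le N); first exact: leqW.
  exists (fun j x => c j * h j x); split => //.
  - by move=> j; apply: smoothM => //; exact: smooth_cst.
  - by move=> j x; rewrite sphZ // he mulrCA.
have sphk x : sph k x = - \sum_(0 <= j < N) c j * sph_eig j * h j x.
  rewrite /k sph_sum; last by move=> j; apply: smoothM => //; exact: smooth_cst.
  by rewrite -sumrN; apply: eq_bigr => j _; rewrite sphZ // he mulNr mulrN mulrA.
pose r x := p x + -1 * k x.
have sr : smooth r by apply: smoothD => //; apply: smoothM => //; exact: smooth_cst.
have sphr x : sph r x = - sph_eig d * r x.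
  rewrite /r sphD //; last by apply: smoothM => //; exact: smooth_cst.
  rewrite sphZ // pE sphk hg.
  have : sph_eig d * k x = \sum_(0 <= j < N) h j x + \sum_(0 <= j < N) c j * sph_eig j * h j x.
    rewrite /k mulr_sumr -big_split; apply: eq_big_nat => j /andP[_ jN] /=.
    have cj : c j * (sph_eig d - sph_eig j) = 1.
      by rewrite mulVf // subr_eq0 gt_eqF // sph_eig_lt // (leq_trans jN).
    by rewrite -[X in X + _]mul1r -cj; ring.
  by move: (k x) (\sum_(_ <= _ < _) _) (\sum_(_ <= _ < _) _) => u v w; lra.
have er : eigsum d.+1 r.
  exists (fun j => if j == d then r else fun=> 0); split.
  - by move=> j; case: ifP => // _; exact: smooth_cst.
  - by move=> j x; case: eqP => [->//|_]; rewrite sph0 mulr0.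
  - move=> x; rewrite big_nat_recr //= eqxx big_nat big1 ?add0r // => j /andP[_ jd].
    by rewrite ltn_eqF.
rewrite (_ : p = fun x => r x + k x); first exact: eigsumD.
by apply/funext => x; rewrite /r mulN1r subrK.
Qed.

(** By [sph_hpoly], (S + sph_eig d) p = |x|^2 Delta p, and Delta p is homogeneous of
    degree d - 2; this replaces the decomposition into harmonic polynomials. *)
Lemma hpoly_eigsum d p : hpoly d p -> eigsum d.+1 p.
Proof.
elim/ltn_ind: d p => -[|[|d]] IH p hp.
- apply: (eigsum_step (leq0n _) (hpoly_smooth hp) eigsum0) => x.
  by rewrite (sph_hpoly _ hp) (hpoly_laplacian_lt2 _ hp) // mulr0.
- apply: (eigsum_step (leq0n _) (hpoly_smooth hp) eigsum0) => x.
  by rewrite (sph_hpoly _ hp) (hpoly_laplacian_lt2 _ hp) // mulr0.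
- have hl : eigsum d.+1 (laplacian p) by apply: IH; [|exact: hpoly_laplacian].
  apply: (eigsum_step _ (hpoly_smooth hp) (eigsum_sqn hl)) => [|x].
    exact: leqnSn.
  by rewrite (sph_hpoly _ hp) mulrC.
Qed.

End polynomials.

Section poly.
Context {R : realType} {n : nat}.
Implicit Types (f g p q : 'rV[R]_n -> R) (x : 'rV[R]_n).

Inductive polyf : ('rV[R]_n -> R) -> Prop :=
| polyf_h d p : hpoly d p -> polyf p
| polyfD p q : polyf p -> polyf q -> polyf (fun x => p x + q x).

Lemma polyf_cst a : polyf (fun=> a).
Proof. exact/polyf_h/hpolyC. Qed.

Lemma polyf_coordM i p : polyf p -> polyf (fun x => x ord0 i * p x).
Proof.
elim=> {p} [d p hp|p q _ hp _ hq]; first exact/polyf_h/(hpolyX i hp).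
by under eq_fun do rewrite mulrDr; exact: polyfD.
Qed.

Lemma polyfZ a p : polyf p -> polyf (fun x => a * p x).
Proof.
elim=> {p} [d p hp|p q _ hp _ hq]; first exact/polyf_h/(hpolyZ a hp).
by under eq_fun do rewrite mulrDr; exact: polyfD.
Qed.

Lemma polyf_coord i : polyf (fun x => x ord0 i).
Proof.
by have := polyf_coordM i (polyf_cst 1); under eq_fun do rewrite mulr1.
Qed.

Lemma polyfM p q : polyf p -> polyf q -> polyf (fun x => p x * q x).
Proof.
move=> + hq; elim=> {p} [d p hp|p p' _ hp _ hp'].
  elim: hp => {d p} [d|a|i d p _ hp|d p p' _ hp _ hp'].
  - by under eq_fun do rewrite mul0r; exact: polyf_cst.
  - exact: polyfZ.
  - by under eq_fun do rewrite -mulrA; exact: polyf_coordM.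
  - by under eq_fun do rewrite mulrDl; exact: polyfD.
by under eq_fun do rewrite mulrDl; exact: polyfD.
Qed.

Lemma polyf_eigsum p : (2 <= n)%N -> polyf p -> exists N, eigsum N p.
Proof.
move=> n2; elim=> {p} [d p hp|p q _ [N hp] _ [M hq]].
  by exists d.+1; exact: hpoly_eigsum.
exists (maxn N M); apply: eigsumD.
  exact: eigsum_le (leq_maxl _ _) hp.
exact: eigsum_le (leq_maxr _ _) hq.
Qed.

End poly.

(** * Bernstein approximation on a cube *)

Section bernstein.
Context {R : realType}.

(** The expectation of g for the binomial law with parameters N and s, computed by
    conditioning on the first trial: the Bernstein polynomial of g. *)
Fixpoint bern (N : nat) (s : R) (g : nat -> R) : R :=
  if N is N'.+1 then (1 - s) * bern N' s g + s * bern N' s (g \o S) else g 0%N.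

Lemma bern_cst N s c : bern N s (fun=> c) = c.
Proof. by elim: N => //= N IH; rewrite (_ : _ \o S = fun=> c) // IH; ring. Qed.

Lemma bernD N s g h : bern N s (fun k => g k + h k) = bern N s g + bern N s h.
Proof.
elim: N g h => //= N IH g h.
by rewrite IH -[_ \o S]/(fun k => g k.+1 + h k.+1) IH /comp; ring.
Qed.

Lemma bernZ N s a g : bern N s (fun k => a * g k) = a * bern N s g.
Proof.
elim: N g => //= N IH g.
by rewrite IH -[_ \o S]/(fun k => a * g k.+1) IH /comp; ring.
Qed.

Lemma bern_le N s g h : 0 <= s <= 1 -> (forall k, g k <= h k) -> bern N s g <= bern N s h.
Proof.
move=> /andP[s0 s1]; elim: N g h => /= [//|N IH] g h gh.
rewrite lerD // ler_wpM2l ?subr_ge0 //; apply: IH => // k; exact: gh.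
Qed.

(** At c = 0 this is the variance; the shift c is what the induction needs. *)
Lemma bern_var N s c : bern N s (fun k => (k%:R - N%:R * s + c) ^+ 2) = N%:R * s * (1 - s) + c ^+ 2.
Proof.
elim: N c => /= [|N IH] c; first by ring.
rewrite (_ : (fun k => _) = fun k => (k%:R - N%:R * s + (c - s)) ^+ 2); last first.
  by apply/funext => k; rewrite -natr1; ring.
rewrite (_ : _ \o S = fun k => (k%:R - N%:R * s + (1 + (c - s))) ^+ 2); last first.
  by apply/funext => k; rewrite /= -natr1; ring.
by rewrite !IH -natr1; ring.
Qed.

Context {n : nat}.
Implicit Types (f : 'rV[R]_n -> R) (x : 'rV[R]_n).

Lemma bern_polyf N (s : 'rV[R]_n -> R) (g : nat -> 'rV[R]_n -> R) : polyf s ->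
  (forall k, polyf (g k)) -> polyf (fun x => bern N (s x) (g ^~ x)).
Proof.
move=> ps; elim: N g => [|N IH] g pg /=; first exact: pg.
apply: polyfD; apply: polyfM => //; try exact: IH.
- apply: polyfD; first exact: polyf_cst.
  by under eq_fun do rewrite -mulN1r; exact: polyfZ.
Qed.

Definition upd (k : 'I_n -> nat) i m : 'I_n -> nat := fun j => if j == i then m else k j.

(** Independent binomial variables for the coordinates listed in l; k holds the
    values of those that are already drawn. *)
Fixpoint mbern (N : nat) (s : 'I_n -> R) (l : seq 'I_n) (k : 'I_n -> nat)
    (F : ('I_n -> nat) -> R) : R :=
  if l is i :: l' then bern N (s i) (fun m => mbern N s l' (upd k i m) F) else F k.

Lemma mbern_polyf N (s : 'I_n -> 'rV[R]_n -> R) l k F : (forall i, polyf (s i)) ->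
  polyf (fun x => mbern N (s ^~ x) l k F).
Proof.
move=> ps; elim: l k => [|i l IH] k /=; first exact: polyf_cst.
exact: (@bern_polyf _ (s i) (fun m x => mbern N (s ^~ x) l (upd k i m) F)).
Qed.

Lemma mbern_cst N s l k c : mbern N s l k (fun=> c) = c.
Proof.
elim: l k => //= i l IH k.
by under [X in bern _ _ X]eq_fun do rewrite IH; exact: bern_cst.
Qed.

Lemma mbernD N s l k F G :
  mbern N s l k (fun k => F k + G k) = mbern N s l k F + mbern N s l k G.
Proof.
elim: l k => //= i l IH k.
by under [X in bern _ _ X]eq_fun do rewrite IH; exact: bernD.
Qed.

Lemma mbernZ N s l k a F : mbern N s l k (fun k => a * F k) = a * mbern N s l k F.
Proof.
elim: l k => //= i l IH k.
by under [X in bern _ _ X]eq_fun do rewrite IH; exact: bernZ.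
Qed.

Lemma mbern_sum N s l k (I : Type) (r : seq I) (F : I -> ('I_n -> nat) -> R) :
  mbern N s l k (fun k => \sum_(j <- r) F j k) = \sum_(j <- r) mbern N s l k (F j).
Proof.
elim: r => [|j r IH].
  by under [X in mbern _ _ _ _ X]eq_fun do rewrite big_nil; rewrite big_nil mbern_cst.
by under [X in mbern _ _ _ _ X]eq_fun do rewrite big_cons; rewrite big_cons mbernD IH.
Qed.

Lemma mbern_le N s l k F G : (forall i, 0 <= s i <= 1) ->
  (forall k, F k <= G k) -> mbern N s l k F <= mbern N s l k G.
Proof.
move=> s01 FG; elim: l k => [|i l IH] k //=.
by apply: bern_le => // m; exact: IH.
Qed.

Lemma mbern_coord N s l k i (h : nat -> R) : uniq l ->
  mbern N s l k (fun k => h (k i)) = if i \in l then bern N (s i) h else h (k i).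
Proof.
elim: l k => //= j l IH k /andP[jl ul].
under [X in bern _ _ X]eq_fun do rewrite IH //.
rewrite in_cons; case: eqVneq => [->|ij] /=.
  rewrite (negbTE jl); congr bern; apply/funext => m; by rewrite /upd eqxx.
case: ifP => _; first exact: bern_cst.
by rewrite (_ : (fun _ => _) = fun=> h (k i)) ?bern_cst //; apply/funext => m; rewrite /upd (negbTE ij).
Qed.

Lemma cc_bounded f : cc f -> exists2 M : R, 0 <= M & forall x, `|f x| <= M.
Proof.
move=> [cf [T fT]].
have /compact_bounded [M [Mr hM]] : compact (f @` cube T).
  apply: continuous_compact; last exact: compact_cube.
  exact: continuous_subspaceT.
exists (`|M| + 1) => [|x]; first by rewrite addr_ge0.
have [cx|ncx] := pselect (cube T x); last by rewrite (fT _ ncx) normr0 addr_ge0.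
apply: (hM (`|M| + 1)); last by exists x.
by rewrite (le_lt_trans (ler_norm _)) // ltrDl.
Qed.

Lemma unif_cont_cube f (T ep : R) : continuous f -> 0 < ep -> exists2 dl : R, 0 < dl &
  forall x y, cube T x -> ball x dl y -> `|f x - f y| < ep.
Proof.
move=> cf ep0.
have /compact_near_coveringP cK := @compact_cube R n T.
have H : \forall dl \near 0^'+, forall x, cube T x -> forall y, ball x dl y -> `|f x - f y| < ep.
  apply: (cK _ _ (fun dl x => forall y, ball x dl y -> `|f x - f y| < ep)) => x cx.
  have : nbhs x [set z | `|f x - f z| < ep / 2].
    have /cvgrPdist_lt := cf x; apply; lra.
  move=> /nbhs_ballP[d /= d0 hd].
  exists (ball x (d / 2), [set dl | dl < d / 2]).
    split; first by apply: nbhsx_ballx; lra.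
    by apply: nbhs_right_lt; lra.
  move=> [z dl] [/= xz dld] y zy.
  have fz : `|f x - f z| < ep / 2 by apply: hd; apply: le_ball xz; lra.
  have fy : `|f x - f y| < ep / 2.
    apply: hd; rewrite [d]splitr; apply: ball_triangle xz _; apply: le_ball zy; lra.
  rewrite (le_lt_trans (ler_distD (f x) _ _)) // (distrC (f z)); lra.
have : \forall dl \near (0 : R)^'+, 0 < dl /\ forall x, cube T x -> forall y, ball x dl y -> `|f x - f y| < ep.
  by apply: filterI => //; exact: nbhs_right_gt.
by move=> /filter_ex[dl [dl0 hdl]]; exists dl => // x y cx; exact: hdl.
Qed.

(** Uniform continuity in the form that a bound on variances can exploit: where x
    and y are not close, the quadratic term exceeds the oscillation of f. *)
Lemma quadratic_modulus f (T ep : R) : cc f -> 0 < ep -> exists2 C : R, 0 <= C &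
  forall x y, cube T x -> `|f y - f x| <= ep + C * \sum_i (y ord0 i - x ord0 i) ^+ 2.
Proof.
move=> cf ep0; have [M M0 hM] := cc_bounded cf.
have [dl dl0 hdl] := unif_cont_cube T cf.1 ep0.
have C0 : 0 <= 2 * M / dl ^+ 2 by apply: divr_ge0; [exact: mulr_ge0|exact: sqr_ge0].
exists (2 * M / dl ^+ 2) => // x y cx.
have s0 : 0 <= \sum_i (y ord0 i - x ord0 i) ^+ 2 by apply: sumr_ge0 => i _; exact: sqr_ge0.
have [xy|nxy] := pselect (ball x dl y).
  by have := hdl _ _ cx xy; rewrite distrC => /ltW h; rewrite (le_trans h) // lerDl mulr_ge0.
have [i hi] : exists i, dl <= `|x ord0 i - y ord0 i|.
  apply: contrapT => /forallNP H; apply: nxy; apply/rV_boxE => // i.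
  by rewrite ltNge; apply/negP; exact: H.
have : 2 * M <= 2 * M / dl ^+ 2 * \sum_i (y ord0 i - x ord0 i) ^+ 2.
  rewrite -mulrA ler_peMr ?mulr_ge0 // mulrC ler_pdivlMr ?exprn_gt0 // mul1r.
  rewrite (bigD1 i) //= ler_wpDr //; first by apply: sumr_ge0 => j _; exact: sqr_ge0.
  by rewrite -[X in _ <= X](real_normK (num_real _)) distrC ler_pXn2r // nnegrE ?normr_ge0 // ltW.
have : `|f y - f x| <= 2 * M.
  by rewrite (le_trans (ler_normB _ _)) // mulrC mulr_natr mulr2n lerD.
lra.
Qed.

(** The Bernstein polynomial averages f over grid points that are concentrated
    around x, with variance at most T^2 / N in each coordinate. *)
Lemma weierstrass_cube f (T ep : R) : cc f -> 0 < T -> 0 < ep ->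
  exists2 p, polyf p & forall x, cube T x -> `|f x - p x| <= ep.
Proof.
move=> cf T0 ep0.
have ep20 : 0 < ep / 2 by lra.
have [C C0 hC] := quadratic_modulus T cf ep20.
pose N := (Num.trunc (2 * C * n%:R * T ^+ 2 / ep)).+1.
have N0 : 0 < N%:R :> R by rewrite ltr0n.
pose node (k : 'I_n -> nat) : 'rV[R]_n := \row_i (2 * T / N%:R * (k i)%:R - T).
pose s i (x : 'rV[R]_n) : R := (2 * T)^-1 * (x ord0 i + T).
have ps i : polyf (s i).
  by apply: polyfZ; apply: polyfD; [exact: polyf_coord|exact: polyf_cst].
pose p x := mbern N (s ^~ x) (index_enum 'I_n) (fun=> 0%N) (fun k => f (node k)).
exists p; first exact: mbern_polyf.
move=> x cx.
have s01 i : 0 <= s i x <= 1.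
  have := cx i; rewrite ler_norml => /andP[x1 x2].
  by rewrite /s mulrC divr_ge0 ?ler_pdivrMr; lra.
pose E F := mbern N (s ^~ x) (index_enum 'I_n) (fun=> 0%N) F.
have Eq : E (fun k => C * \sum_i (node k ord0 i - x ord0 i) ^+ 2) <= ep / 2.
  rewrite /E mbernZ mbern_sum.
  have Ei i : mbern N (s ^~ x) (index_enum 'I_n) (fun=> 0%N)
     (fun k => (node k ord0 i - x ord0 i) ^+ 2) <= T ^+ 2 / N%:R.
    rewrite (_ : (fun k => _) = fun k => (fun m : nat => (2 * T / N%:R) ^+ 2 * (m%:R - N%:R * s i x + 0) ^+ 2) (k i)); last first.
      apply/funext => k; rewrite /node mxE /s; field; lra.
    rewrite (mbern_coord _ _ _ i (fun m : nat => (2 * T / N%:R) ^+ 2 * (m%:R - N%:R * s i x + 0) ^+ 2)) ?index_enum_uniq //.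
    rewrite mem_index_enum bernZ bern_var.
    have := s01 i; move: (s i x) => u /andP[u0 u1].
    have -> : (2 * T / N%:R) ^+ 2 * (N%:R * u * (1 - u) + 0 ^+ 2) = T ^+ 2 / N%:R * (4 * u * (1 - u)).
      by field; lra.
    apply: ler_piMr; first by apply: divr_ge0; [exact: sqr_ge0|exact: ltW].
    rewrite -subr_ge0 (_ : 1 - _ = (2 * u - 1) ^+ 2); first exact: sqr_ge0.
    by ring.
  have : \sum_i mbern N (s ^~ x) (index_enum 'I_n) (fun=> 0%N)
     (fun k => (node k ord0 i - x ord0 i) ^+ 2) <= n%:R * (T ^+ 2 / N%:R).
    apply: le_trans (ler_sum _ (fun i _ => Ei i)) _.
    by rewrite sumr_const card_ord mulr_natl.
  move=> /(ler_wpM2l C0) /le_trans; apply.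
  have : 2 * C * n%:R * T ^+ 2 / ep < N%:R by exact: truncnS_gt.
  rewrite ltr_pdivrMr // => H.
  rewrite !mulrA ler_pdivrMr //; lra.
have EE : p x = E (fun k => f (node k)) by [].
have up : E (fun k => f (node k)) <= f x + ep.
  apply: (@le_trans _ _ (E (fun k => (f x + ep / 2) + C * \sum_i (node k ord0 i - x ord0 i) ^+ 2))).
    apply: mbern_le => // k; have := hC x (node k) cx.
    by rewrite ler_norml => /andP[_]; lra.
  by rewrite /E mbernD mbern_cst -/(E _); lra.
have lo : f x - ep <= E (fun k => f (node k)).
  apply: (@le_trans _ _ (E (fun k => (f x - ep / 2) + -1 * (C * \sum_i (node k ord0 i - x ord0 i) ^+ 2)))).
    by rewrite /E mbernD mbern_cst mbernZ -/(E _); lra.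
  apply: mbern_le => // k; have := hC x (node k) cx.
  by rewrite ler_norml => /andP[+ _]; lra.
rewrite EE ler_norml; apply/andP; split; lra.
Qed.

End bernstein.

(** * Orthogonal families and Bessel's inequality *)

Section orthogonal.
Context {R : realType} {n : nat}.
Implicit Types (f g p q : 'rV[R]_n -> R) (x : 'rV[R]_n).

Definition ip f g : R := Int (fun x => f x * g x).

Lemma ipC f g : ip f g = ip g f.
Proof. by congr Int; apply/funext => x; rewrite mulrC. Qed.

Lemma ip_ge0 f : 0 <= ip f f.
Proof. by apply: Int_ge0 => x; rewrite -expr2 sqr_ge0. Qed.

Lemma ipDr f g h : cc f -> cc g -> cc h -> ip f (fun x => g x + h x) = ip f g + ip f h.
Proof.
move=> cf cg ch; rewrite /ip -IntD; [|exact: ccM|exact: ccM].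
by congr Int; apply/funext => x; rewrite mulrDr.
Qed.

Lemma ipZr f g a : cc f -> cc g -> ip f (fun x => a * g x) = a * ip f g.
Proof.
move=> cf cg; rewrite /ip -IntZ; last exact: ccM.
by congr Int; apply/funext => x; rewrite mulrCA.
Qed.

Lemma ip_sumr (I : Type) (s : seq I) (P : I -> 'rV[R]_n -> R) b f : cc f ->
  (forall j, cc (P j)) ->
  ip f (fun x => \sum_(j <- s) b j * P j x) = \sum_(j <- s) b j * ip f (P j).
Proof.
move=> cf cP; rewrite /ip.
transitivity (Int (fun x => \sum_(j <- s) b j * (f x * P j x))).
  by congr Int; apply/funext => x; rewrite mulr_sumr; apply: eq_bigr => j _; rewrite mulrCA.
rewrite Int_sum; last by move=> j; apply: ccZ; exact: ccM.
by apply: eq_bigr => j _; rewrite IntZ //; exact: ccM.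
Qed.

Lemma ip_sq_sub f g : cc f -> cc g ->
  ip (fun x => f x - g x) (fun x => f x - g x) = ip f f - 2 * ip f g + ip g g.
Proof.
move=> cf cg; have [cff cfg cgg] := And3 (ccM cf cf) (ccM cf cg) (ccM cg cg).
rewrite /ip -IntZ // -IntB //; last exact: ccZ.
rewrite -IntD //; last by apply: ccD => //; under eq_fun do rewrite -mulN1r; do 2 apply: ccZ.
by congr Int; apply/funext => x; ring.
Qed.

Section family.
Variables (N : nat) (P : 'I_N -> 'rV[R]_n -> R).
Hypothesis cP : forall j, cc (P j).
Hypothesis orthP : forall i j, i != j -> ip (P i) (P j) = 0.

Lemma cc_comb b : cc (fun x => \sum_j b j * P j x).
Proof. by apply: cc_sum => j; exact: ccZ. Qed.

Lemma orth_expand f b : cc f ->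
  ip (fun x => f x - \sum_j b j * P j x) (fun x => f x - \sum_j b j * P j x) =
  ip f f - 2 * (\sum_j b j * ip f (P j)) + \sum_j b j ^+ 2 * ip (P j) (P j).
Proof.
move=> cf; rewrite ip_sq_sub //; last exact: cc_comb.
rewrite ip_sumr //; congr (_ + _).
rewrite ip_sumr //; last exact: cc_comb.
apply: eq_bigr => j _; rewrite ipC ip_sumr // (bigD1 j) //= big1 ?addr0.
  by rewrite mulrA expr2.
by move=> i ij; rewrite orthP ?mulr0 // eq_sym.
Qed.

(** The degenerate case of the Cauchy-Schwarz inequality. *)
Lemma ip_null f g : cc f -> cc g -> ip g g = 0 -> ip f g = 0.
Proof.
move=> cf cg g0; apply/eqP/negPn/negP => fg.
pose s := (ip f f + 1) / (2 * ip f g).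
have := ip_ge0 (fun x => f x - s * g x).
have csg := ccZ s cg.
rewrite (ip_sq_sub cf csg) (ipZr _ cf cg) (ipZr _ csg cg) (ipC (fun x => s * g x) g) (ipZr _ cg cg) g0 !mulr0 addr0.
rewrite (_ : 2 * (s * ip f g) = ip f f + 1); last by rewrite /s; field; exact: fg.
by have := ip_ge0 f; lra.
Qed.

Variables (w m : 'rV[R]_n -> R) (d : 'I_N -> R).
Hypotheses (cw : cc w) (cm : cc m).
Hypothesis md : forall j, ip m (P j) = d j * ip w (P j).
Hypothesis d_gap : forall j, 0 <= d j * (d j + 1).

(** If w were in the span of the P j, with w = sum_j a_j P_j, the right-hand side
    would be the sum of d_j (d_j + 1) a_j^2 |P_j|^2. In general, let the a_j be the
    coefficients of the orthogonal projection of w: Bessel's inequality for m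
    still bounds |m|^2 from below, and Young's inequality bounds the product of
    m with the rest of w. That rest is not longer than w - sum_j P_j, because
    the projection is the best approximation. *)
Lemma spectral_gap_approx dl : 0 < dl ->
  - (dl * ip m m + (4 * dl)^-1 *
      ip (fun x => w x - \sum_j P j x) (fun x => w x - \sum_j P j x))
  <= ip m (fun x => m x + w x).
Proof.
move=> dl0.
pose c j := ip w (P j); pose N2 j := ip (P j) (P j); pose a j := c j / N2 j.
have N20 j : 0 <= N2 j by exact: ip_ge0.
have aN j : a j ^+ 2 * N2 j = a j * c j.
  rewrite /a; have [->|Nj] := eqVneq (N2 j) 0; first by rewrite invr0 !mulr0 mul0r.
  by field.
have ac0 j : 0 <= a j * c j by rewrite -aN mulr_ge0 // sqr_ge0.
have bessel : \sum_j (d j ^+ 2 * (a j * c j)) <= ip m m.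
  have := ip_ge0 (fun x => m x - \sum_j (d j * a j) * P j x).
  rewrite orth_expand //.
  rewrite (eq_bigr (fun j => d j ^+ 2 * (a j * c j))); last first.
    by move=> j _; rewrite md /c; ring.
  rewrite [X in _ + X](eq_bigr (fun j => d j ^+ 2 * (a j * c j))); last first.
    by move=> j _; rewrite exprMn -mulrA aN.
  by move: (\sum_j _) (ip m m) => u v; lra.
pose g x := w x - \sum_j a j * P j x.
have cg : cc g.
  rewrite /g; under eq_fun do rewrite -mulN1r.
  by apply: ccD => //; apply: ccZ; exact: cc_comb.
have best : ip g g <= ip (fun x => w x - \sum_j P j x) (fun x => w x - \sum_j P j x).
  have -> : (fun x => w x - \sum_j P j x) = fun x => w x - \sum_j 1 * P j x.
    by apply/funext => x; congr (_ - _); apply: eq_bigr => j _; rewrite mul1r.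
  rewrite !orth_expand // -subr_ge0.
  rewrite (_ : _ - _ = \sum_j (N2 j - 2 * c j + a j * c j)).
    apply: sumr_ge0 => j _; have [Nj|Nj] := eqVneq (N2 j) 0.
      by rewrite Nj [c j]ip_null // mulr0 subr0 mulr0 addr0.
    rewrite (_ : _ + _ = (N2 j - c j) ^+ 2 / N2 j); first by rewrite divr_ge0 // sqr_ge0.
    by rewrite /a; field.
  rewrite !big_split /= sumrN -!mulr_sumr.
  rewrite [\sum_j a j ^+ 2 * _](eq_bigr (fun j => a j * c j)); last by move=> j _; exact: aN.
  rewrite expr1n !mul1r -[\sum_j a j * ip w _]/(\sum_j a j * c j).
  rewrite -[\sum_j ip w (P j)]/(\sum_j c j) -[\sum_j ip (P j) (P j)]/(\sum_j N2 j).
  by move: (\sum_j c j) (\sum_j N2 j) (\sum_j a j * c j) (ip w w) => u1 u2 u3 u4; lra.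
have mw : ip m (fun x => m x + w x) = ip m m + \sum_j a j * (d j * c j) + ip m g.
  have -> : (fun x => m x + w x) = fun x => m x + ((fun x => \sum_j a j * P j x) x + g x).
    by apply/funext => x; rewrite /g [in RHS](addrC (w x)) addNKr.
  rewrite ipDr //; last by apply: ccD => //; exact: cc_comb.
  rewrite ipDr //; last exact: cc_comb.
  rewrite ip_sumr // addrA; congr (_ + _ + _).
  by apply: eq_bigr => j _; rewrite md.
have young : - (dl * ip m m + (4 * dl)^-1 * ip g g) <= ip m g.
  rewrite -subr_ge0 opprK /ip -!IntZ; try exact: ccM.
  rewrite -!IntD; try (apply: ccD); try (apply: ccZ); try exact: ccM.
  apply: Int_ge0 => x.
  rewrite (_ : _ + _ = dl * (m x + (2 * dl)^-1 * g x) ^+ 2).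
    by rewrite mulr_ge0 ?sqr_ge0 // ltW.
  by field; lra.
have pos : 0 <= \sum_j (d j ^+ 2 * (a j * c j)) + \sum_j a j * (d j * c j).
  rewrite -big_split; apply: sumr_ge0 => j _ /=.
  rewrite (_ : _ + _ = (d j * (d j + 1)) * (a j * c j)); last by ring.
  by rewrite mulr_ge0.
have dl4 : 0 <= (4 * dl)^-1 by rewrite invr_ge0; lra.
have := ler_wpM2l dl4 best.
rewrite mw; lra.
Qed.
End family.
End orthogonal.

(** * The spectral gap of the spherical Laplacian *)

Section cutoff.
Context {R : realType}.

Definition pos (s : R) : R := (s + `|s|) / 2.

Lemma posE (s : R) : pos s = if 0 <= s then s else 0.
Proof.
rewrite /pos; case: ifP => [s0|/negbT]; first by rewrite ger0_norm //; field.
by rewrite -ltNge => s0; rewrite ltr0_norm // subrr mul0r.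
Qed.

Lemma continuous_pos : continuous pos.
Proof.
move=> s; apply: cvgM; last exact: cvg_cst.
by apply: cvgD; [exact: cvg_id|exact: norm_continuous].
Qed.

(** A second order remainder that does not notice the corner of [pos] at 0. *)
Lemma pos_sq_taylor (s h : R) : `|pos (h + s) ^+ 2 - pos s ^+ 2 - h * (2 * pos s)| <= h ^+ 2.
Proof.
rewrite !posE; case: (leP 0 (h + s)) => hs; case: (leP 0 s) => s0;
  rewrite ler_norml; apply/andP; split; nra.
Qed.

Lemma is_derive_pos_sq (s : R) : is_derive s 1 (fun t => pos t ^+ 2) (2 * pos s).
Proof.
have H : h^-1 *: (((fun t => pos t ^+ 2) \o shift s) (h *: (1 : R)) - pos s ^+ 2)
    @[h --> (0 : R)^'] --> 2 * pos s.
  apply/cvgrPdist_lt => ep ep0; near=> h.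
  have h0 : h != 0 by near: h; exact: nbhs_dnbhs_neq.
  have hep : `|h| < ep by near: h; apply: dnbhs0_lt.
  apply: le_lt_trans hep; rewrite /= [h%:A]mulr1 -[_ *: _]/(_ * _).
  have hn : 0 < `|h| by rewrite normr_gt0.
  rewrite -(ler_pM2l hn) -normrM -expr2 real_normK ?num_real //.
  have -> : h * (2 * pos s - h^-1 * (pos (h + s) ^+ 2 - pos s ^+ 2)) =
      - (pos (h + s) ^+ 2 - pos s ^+ 2 - h * (2 * pos s)) by field.
  by rewrite normrN; exact: pos_sq_taylor.
apply: DeriveDef; first by apply/cvg_ex; exists (2 * pos s).
exact: cvg_lim H.
Unshelve. all: by end_near. Qed.

Context {n : nat}.
Implicit Types (f g p q : 'rV[R]_n -> R) (x : 'rV[R]_n).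
Local Notation e i := (delta_mx ord0 i : 'rV[R]_n).

(** A radial C^1 function that is positive exactly for |x|^2 < T. *)
Definition cutoff (T : R) x : R := pos (T - sqn x) ^+ 2.

Lemma is_derive_cutoff T i x :
  is_derive x (e i) (cutoff T) (2 * pos (T - sqn x) * (-1 * (2 * x ord0 i))).
Proof.
apply: (is_derive_comp1 (is_derive_pos_sq _) (f := fun x => T - sqn x)).
have : is_derive x (e i) (cst T - @sqn R n) (0 - 2 * x ord0 i).
  by apply: is_deriveB; exact: is_derive_sqn.
by rewrite sub0r mulN1r.
Qed.

Lemma continuous_pos_sqn T : continuous (fun x : 'rV[R]_n => pos (T - sqn x)).
Proof.
move=> x; apply: (@continuous_comp _ _ _ (fun x : 'rV[R]_n => T - sqn x) pos).
  by apply: continuousB; [exact: cst_continuous|exact: smooth_cont smooth_sqn x].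
exact: continuous_pos.
Qed.

Lemma continuous_mulR f g : continuous f -> continuous g -> continuous (fun x => f x * g x).
Proof. by move=> cf cg x; apply: continuousM; [exact: cf|exact: cg]. Qed.

Lemma cutoff_Ck1 T : Ck 1 (cutoff T).
Proof.
have cp := @continuous_pos_sqn T; split.
  rewrite (_ : cutoff T = fun x => pos (T - sqn x) * pos (T - sqn x)); first exact: continuous_mulR.
  by apply/funext => x; rewrite /cutoff expr2.
move=> i; split => [x|].
  exact: (@ex_derive _ _ _ _ _ _ _ (is_derive_cutoff T i x)).
rewrite (_ : partial i (cutoff T) = fun x => 2 * pos (T - sqn x) * (-1 * (2 * x ord0 i))).
  split => //; apply: continuous_mulR; first by apply: continuous_mulR => // x; exact: cst_continuous.
  apply: continuous_mulR; first by move=> x; exact: cst_continuous.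
  apply: continuous_mulR; first by move=> x; exact: cst_continuous.
  exact: coord_continuous.
by apply/funext => x; exact: (@derive_val _ _ _ _ _ _ _ (is_derive_cutoff T i x)).
Qed.

Lemma rot_cutoff T i j x : rot i j (cutoff T) x = 0.
Proof.
by rewrite /rot /partial !(@derive_val _ _ _ _ _ _ _ (is_derive_cutoff _ _ _)); ring.
Qed.

Lemma cutoff_eq0 T x : T <= sqn x -> cutoff T x = 0.
Proof.
move=> Tx; rewrite /cutoff posE; case: ifP => [|_]; last by rewrite expr0n.
move=> h; have -> : T - sqn x = 0 by lra.
by rewrite expr0n.
Qed.

Lemma cutoff_gt0 T x : sqn x < T -> 0 < cutoff T x.
Proof. by move=> xT; rewrite /cutoff posE ifT ?exprn_gt0 ?subr_gt0 // subr_ge0 ltW. Qed.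

Lemma sqn_coord x i : x ord0 i ^+ 2 <= sqn x.
Proof.
by rewrite /sqn (bigD1 i) //= lerDl; apply: sumr_ge0 => j _; exact: sqr_ge0.
Qed.

Lemma cutoff_cube T x : 1 <= T -> ~ cube T x -> cutoff T x = 0.
Proof.
move=> T1 /existsNP[i /negP]; rewrite -ltNge => Ti; apply: cutoff_eq0.
apply: le_trans (sqn_coord x i).
by rewrite -[X in _ <= X](real_normK (num_real _)); move: Ti; nra.
Qed.

Lemma cutoff_c1c T : 1 <= T -> c1c (cutoff T).
Proof. by move=> T1; split; [exact: cutoff_Ck1|exists T => x; exact: cutoff_cube]. Qed.

Lemma bsuppMl f g : bsupp g -> bsupp (fun x => f x * g x).
Proof. by move=> [S fS]; exists S => x nx; rewrite fS ?mulr0. Qed.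

Lemma c1c_smoothM T f : 1 <= T -> smooth f -> c1c (fun x => f x * cutoff T x).
Proof.
move=> T1 sf; have [c b] := cutoff_c1c T1.
by split; [apply: Ck1M => //; exact: sf|exact: bsuppMl].
Qed.

Lemma leibniz_cutoff T f : smooth f -> leibniz f (cutoff T).
Proof.
move=> sf i x; apply: partialM; first exact: smooth_derivable.
exact/Ck1_derivable/cutoff_Ck1.
Qed.

Lemma rot_cutoffM T i j f : smooth f ->
  rot i j (fun x => f x * cutoff T x) = fun x => rot i j f x * cutoff T x.
Proof.
move=> sf; apply/funext => x.
by rewrite rotM ?rot_cutoff ?mulr0 ?addr0 //; exact: leibniz_cutoff.
Qed.

Lemma rc2_cutoffM T f : 1 <= T -> smooth f -> rc2 (fun x => f x * cutoff T x).
Proof.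
move=> T1 sf; split=> [|i j]; first exact: c1c_smoothM.
by rewrite rot_cutoffM //; apply: c1c_smoothM => //; exact: smooth_rot.
Qed.

Lemma sph_cutoffM T f : smooth f ->
  sph (fun x => f x * cutoff T x) = fun x => sph f x * cutoff T x.
Proof.
move=> sf; apply: sphMr.
- exact: leibniz_cutoff.
- by move=> i j; apply: leibniz_cutoff; exact: smooth_rot.
- by move=> i j x; rewrite rot_cutoff mulr0.
- by move=> i j x; rewrite rot_cutoff mulr0.
Qed.

(** With T large, w divided by the cutoff is continuous and has bounded support,
    so that Bernstein polynomials approximate it. *)
Lemma approx_cutoff (w : 'rV[R]_n -> R) : cc w -> exists2 T, 1 <= T &
  forall ep, 0 < ep -> exists2 p, polyf p &
    forall x, `|w x - p x * cutoff T x| <= ep * cutoff T x.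
Proof.
move=> [cw [S wS]]; pose T := n%:R * S ^+ 2 + 1.
have T1 : 1 <= T by rewrite lerDr mulr_ge0 // sqr_ge0.
have sqS x : cube S x -> sqn x < T.
  move=> cx; rewrite (@le_lt_trans _ _ (n%:R * S ^+ 2)) ?ltrDl //.
  rewrite /sqn (le_trans (ler_sum _ (_ : forall i, true -> x ord0 i ^+ 2 <= S ^+ 2))) //.
    move=> i _; rewrite -[X in X <= _](real_normK (num_real _)).
    by have := cx i; have := normr_ge0 (x ord0 i); move: `|_| => u; nra.
  by rewrite sumr_const card_ord mulr_natl.
pose v x := w x / cutoff T x.
have wv x : w x = v x * cutoff T x.
  have [xT|xT] := ltP (sqn x) T; first by rewrite /v divfK // gt_eqF // cutoff_gt0.
  rewrite cutoff_eq0 // mulr0 wS // => /sqS; by rewrite ltNge xT.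
have cv : cc v.
  split; last by exists S => x /wS wx; rewrite /v wx mul0r.
  move=> x; have [xT|xT] := ltP (sqn x) T.
    apply: (@continuousM _ _ w (fun y => (cutoff T y)^-1)); first exact: cw.
    apply: (@continuousV _ _ (cutoff T)); first by rewrite gt_eqF // cutoff_gt0.
    exact: (cutoff_Ck1 T).1.
  have nx : ~ cube S x by move=> /sqS; rewrite ltNge xT.
  apply: (@continuous_near_eq _ _ (fun=> 0)); last exact: cst_continuous.
  have := nbhs_notin_cube nx; apply: filterS => y /wS wy.
  by rewrite /v wy mul0r.
exists T => // ep ep0.
have [|p pp hp] := weierstrass_cube cv (_ : 0 < T) ep0; first by lra.
exists p => // x.
have [cx|ncx] := pselect (cube T x); last first.
  by rewrite wv cutoff_cube // !mulr0 subr0 normr0.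
rewrite wv -mulrBl normrM (ger0_norm (sqr_ge0 _)) ler_wpM2r ?sqr_ge0 //.
exact: hp.
Qed.

(** The eigenvalues of lamb + S avoid the open interval from -1 to 0. Products of
    eigenfunctions with the cutoff are orthogonal, since S is symmetric and the
    eigenvalues are distinct, and their sums approximate w; so
    [spectral_gap_approx] applies with an arbitrarily small error. *)
Lemma sph_spectral_gap (lamb : R) (w : 'rV[R]_n -> R) : (2 <= n)%N ->
  (forall d, 0 <= (lamb - @sph_eig R n d) * (lamb - @sph_eig R n d + 1)) -> rc2 w ->
  0 <= Int (fun x => (lamb * w x + sph w x) * (lamb * w x + sph w x + w x)).
Proof.
move=> n2 gap rw; have cw := c1c_cc rw.1.
pose m x := lamb * w x + sph w x.
have cm : cc m by apply: ccD; [exact: ccZ|exact: cc_sph].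
have [T T1 hT] := approx_cutoff cw.
pose K := ip m m + 4^-1 * ip (cutoff T) (cutoff T).
have ceta := c1c_cc (cutoff_c1c T1).
suff H dl : 0 < dl -> - (dl * K) <= ip m (fun x => m x + w x).
  change (0 <= ip m (fun x => m x + w x)).
  rewrite leNgt; apply/negP => X0.
  have K0 : 0 <= K by rewrite addr_ge0 ?ip_ge0 // mulr_ge0 // ip_ge0.
  pose dl := - ip m (fun x => m x + w x) / (2 * (K + 1)).
  have dl0 : 0 < dl by rewrite divr_gt0 ?oppr_gt0 //; lra.
  have := H _ dl0; have : dl * (2 * (K + 1)) = - ip m (fun x => m x + w x).
    by rewrite /dl divfK //; lra.
  nra.
move=> dl0; have [p /(polyf_eigsum n2)[N [h [hs he hp]]] pw] := hT _ dl0.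
pose P (j : 'I_N) x := h j x * cutoff T x.
have rP j : rc2 (P j) by apply: rc2_cutoffM.
have cP j : cc (P j) by exact: c1c_cc (rP j).1.
have sP j x : sph (P j) x = - @sph_eig R n j * P j x.
  by rewrite /P sph_cutoffM // he -mulrA.
have orthP (i j : 'I_N) : i != j -> ip (P i) (P j) = 0.
  move=> ij; have := Int_sphC (rP i) (rP j).
  have -> : Int (fun x => sph (P i) x * P j x) = - @sph_eig R n i * ip (P i) (P j).
    rewrite /ip -IntZ; last exact: ccM.
    by congr Int; apply/funext => x; rewrite sP mulrA.
  have -> : Int (fun x => P i x * sph (P j) x) = - @sph_eig R n j * ip (P i) (P j).
    rewrite /ip -IntZ; last exact: ccM.
    by congr Int; apply/funext => x; rewrite sP mulrCA.
  move=> /eqP; rewrite -subr_eq0 -mulrBl mulf_eq0 => /orP[|/eqP //].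
  rewrite opprK addrC subr_eq0 => /eqP le.
  have [lt|lt|/val_inj ijE] := ltngtP i j; last by rewrite ijE eqxx in ij.
    by have := @sph_eig_lt R n n2 _ _ lt; rewrite le ltxx.
  by have := @sph_eig_lt R n n2 _ _ lt; rewrite le ltxx.
have md j : ip m (P j) = (lamb - @sph_eig R n j) * ip w (P j).
  rewrite ipC ipDr //; [|exact: ccZ|exact: cc_sph].
  rewrite ipZr // [ip _ (sph w)]ipC -[ip (sph w) _]/(Int _).
  rewrite (Int_sphC rw (rP j)) (_ : Int _ = - @sph_eig R n j * ip w (P j)).
    by rewrite [ip (P j) w]ipC; ring.
  rewrite /ip -IntZ; last exact: ccM.
  by congr Int; apply/funext => x; rewrite sP mulrCA.
have := @spectral_gap_approx R n N P cP orthP w m (fun j => lamb - @sph_eig R n j) cw cm md (fun j => gap j) dl dl0.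
apply: le_trans; rewrite lerN2 /K mulrDr lerD2l.
have : ip (fun x => w x - \sum_j P j x) (fun x => w x - \sum_j P j x) <=
       dl ^+ 2 * ip (cutoff T) (cutoff T).
  rewrite /ip -IntZ; last exact: ccM.
  have cd : cc (fun x => w x - \sum_j P j x).
    under eq_fun do rewrite -mulN1r.
    by apply: ccD => //; apply: ccZ; exact: cc_sum.
  apply: Int_le; [exact: ccM|apply: ccZ; exact: ccM|move=> x].
  have -> : \sum_j P j x = p x * cutoff T x by rewrite hp big_mkord mulr_suml.
  have c0 : 0 <= cutoff T x by exact: sqr_ge0.
  have uc := pw x; have u0 := normr_ge0 (w x - p x * cutoff T x).
  rewrite -expr2 -(real_normK (num_real _)).
  rewrite (_ : dl ^+ 2 * _ = (dl * cutoff T x) ^+ 2); last by ring.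
  by rewrite ler_pXn2r // nnegrE // mulr_ge0 // ltW.
have d4 : 0 <= (4 * dl)^-1 by rewrite invr_ge0; lra.
move=> /(ler_wpM2l d4) /le_trans; apply.
rewrite le_eqVlt; apply/orP; left; apply/eqP; field; lra.
Qed.

End cutoff.

(** * The weighted Rellich inequality in logarithmic coordinates *)

Lemma quadratic_dominates (R : realFieldType) (t u v : R) :
  0 <= u -> 0 <= v -> u + v <= t -> 1 <= t -> 0 <= t ^+ 2 - (u + v * t).
Proof. by move=> u0 v0 uvt t1; nra. Qed.

(** The bookkeeping of [weighted_rellich]. With a = E w, b = E^2 w and m = M w, the
    integrals of a^2, b^2 and m^2 with weight t^c are u1, u3 and u4, those of a^2
    and w m with weight t^(c-1) are u5 and u6, those of w^2 and w m with weight
    t^(c-2) are u2 and u7, and Q is the integral of the spherical gradient of a. *)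
Lemma rellich_arith (R : realFieldType) (A B c u1 u2 u3 u4 u5 u6 u7 Q : R) :
  0 <= 2 * B * c * u5 -> 0 <= u4 + c * (c - 1) * u7 + 2 * B * c * u6 -> 0 <= Q -> 0 <= u3 ->
  2 * (A ^+ 2 + B ^+ 2) * (((1 - c) / 2) ^+ 2 * u2) <= 2 * (A ^+ 2 + B ^+ 2) * u1 ->
  2 * (A ^+ 2 + B ^+ 2) * ((1 - c) / 2) ^+ 2 * u2 <=
  u3 + 4 * B ^+ 2 * u1 + u4 + - (4 * B) * (- c / 2 * u5) +
  2 * (- c * (- (c - 1) / 2 * u7) - (B ^+ 2 - A ^+ 2) * u1 + Q) +
  - (4 * B) * (- c / 2 * u6).
Proof.
move=> h1 h2 h3 h4 h5; rewrite -mulrA; apply: le_trans h5 _; rewrite -subr_ge0.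
rewrite (_ : _ - _ = u3 + (u4 + c * (c - 1) * u7 + 2 * B * c * u6) + 2 * B * c * u5 + 2 * Q).
  lra.
by field.
Qed.

Section weighted_integral.
Context {R : realType} {n : nat}.
Implicit Types (f g p q : 'rV[R]_n -> R) (x : 'rV[R]_n).
Variable O : set 'rV[R]_n.
Hypothesis Oout : O `<=` outside.
Local Notation test := (test_function O).

(** The integral of t^b f against dx / |x|^n, t = log |x|. This measure is invariant
    under dilations and rotations: in the variables t and x / |x| it is a
    product measure, and E integrates by parts as d/dt. *)
Definition Jb (b : R) f : R := Int (fun x => f x * wt (- n%:R) b x).

Lemma test_wt f a b : test f -> test (fun x => f x * wt a b x).
Proof. by move=> tf; apply: testMr Oout tf _; [exact: open_outside|exact: smooth_wt]. Qed.

Lemma cc_wt f a b : test f -> cc (fun x => f x * wt a b x).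
Proof. by move=> tf; apply: test_cc; exact: test_wt. Qed.

Lemma leibniz_wt f a b : test f -> leibniz f (wt a b).
Proof. by move=> tf; apply: leibniz_test Oout tf _; exact: smooth_wt. Qed.

Lemma test_rot_wt0 f a b i j x : test f -> f x * rot i j (wt a b) x = 0.
Proof.
move=> tf; have [/Oout ox|/(test_out0 tf) ->] := pselect (O x); last by rewrite mul0r.
by rewrite rot_wt // mulr0.
Qed.

Lemma rot_wtM f a b i j : test f ->
  rot i j (fun x => f x * wt a b x) = fun x => rot i j f x * wt a b x.
Proof.
move=> tf; apply/funext => x; rewrite rotM ?test_rot_wt0 ?addr0 //.
exact: leibniz_wt.
Qed.

Lemma sph_wtM f a b : test f ->
  sph (fun x => f x * wt a b x) = fun x => sph f x * wt a b x.
Proof.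
move=> tf; apply: sphMr.
- exact: leibniz_wt.
- by move=> i j; apply: leibniz_wt; exact: test_rot.
- by move=> i j x; exact: test_rot_wt0.
- by move=> i j x; apply: test_rot_wt0; exact: test_rot.
Qed.

Lemma euler_wtM f a b x : test f ->
  euler (fun y => f y * wt a b y) x =
  euler f x * wt a b x + f x * (a * wt a b x + b * wt a (b - 1) x).
Proof.
move=> tf; rewrite eulerM; last exact: leibniz_wt.
congr (_ + _); have [/Oout ox|/(test_out0 tf) ->] := pselect (O x).
  by rewrite euler_wt.
by rewrite !mul0r.
Qed.

Lemma JbD b f g : test f -> test g -> Jb b (fun x => f x + g x) = Jb b f + Jb b g.
Proof.
move=> tf tg; rewrite /Jb -IntD; [|exact: cc_wt|exact: cc_wt].
by congr Int; apply/funext => x; rewrite mulrDl.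
Qed.

Lemma JbZ b a f : test f -> Jb b (fun x => a * f x) = a * Jb b f.
Proof.
move=> tf; rewrite /Jb -IntZ; last exact: cc_wt.
by congr Int; apply/funext => x; rewrite mulrA.
Qed.

Lemma Jb_ge0 b f : (forall x, 0 <= f x) -> 0 <= Jb b f.
Proof. by move=> f0; apply: Int_ge0 => x; rewrite mulr_ge0 // ltW // wt_gt0. Qed.

Lemma Jb_euler b f : test f -> Jb b (euler f) = - b * Jb (b - 1) f.
Proof.
move=> tf; pose h x := f x * wt (- n%:R) b x.
have th : test h by exact: test_wt.
have : Int (fun x => \sum_i partial i (fun y => y ord0 i * h y) x) = 0.
  rewrite Int_sum => [|i].
    by rewrite big1 // => i _; apply: Int_partial; apply: c1c_coordM; exact: test_c1c th.
  by apply: c1c_partial; apply: c1c_coordM; exact: test_c1c th.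
rewrite (_ : (fun x => _) = fun x => euler f x * wt (- n%:R) b x + b * (f x * wt (- n%:R) (b - 1) x)).
  rewrite IntD; [|apply: cc_wt; exact: test_euler|apply: ccZ; exact: cc_wt].
  by rewrite IntZ -?/(Jb _ _) => [/eqP|]; [rewrite addr_eq0 mulNr => /eqP|exact: cc_wt].
apply/funext => x.
under eq_bigr => i _ do rewrite (partial_coordM _ _ _ (test_smooth th)) eqxx mul1r.
rewrite big_split /= sumr_const card_ord -/(euler h x) euler_wtM // /h -mulr_natl.
ring.
Qed.

Lemma Jb_sph_grad b f g : test f -> test g ->
  Jb b (fun x => sph f x * g x) =
  - (2^-1 * \sum_i \sum_j Jb b (fun x => rot i j f x * rot i j g x)).
Proof.
move=> tf tg; rewrite /Jb.
transitivity (Int (fun x => sph f x * (g x * wt (- n%:R) b x))).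
  by congr Int; apply/funext => x; rewrite mulrA.
rewrite Int_sph_grad; [|exact: test_rc2 tf|by apply: (@test_c1c _ _ O); exact: test_wt].
apply: (congr1 (fun z => - (2^-1 * z))); apply: eq_bigr => i _; apply: eq_bigr => j _.
by congr Int; rewrite rot_wtM //; apply/funext => x; rewrite mulrA.
Qed.

Lemma Jb_sphC b f g : test f -> test g ->
  Jb b (fun x => sph f x * g x) = Jb b (fun x => f x * sph g x).
Proof.
move=> tf tg; rewrite (Jb_sph_grad b tf tg).
rewrite (_ : (fun x => f x * sph g x) = fun x => sph g x * f x); last first.
  by apply/funext => x; rewrite mulrC.
rewrite (Jb_sph_grad b tg tf).
apply: (congr1 (fun z => - (2^-1 * z))); apply: eq_bigr => i _; apply: eq_bigr => j _.
by congr Jb; apply/funext => x; rewrite mulrC.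
Qed.

Lemma wt_tau2 a b x : outside x -> wt a b x / tau x ^+ 2 = wt a (b - 2) x.
Proof.
move=> ox; rewrite (_ : b - 2 = b - 1 - 1); last by ring.
rewrite -!wt_tau //; field; exact/lt0r_neq0/tau_gt0.
Qed.

Ltac tst := solve [repeat first [assumption | apply: test_euler | apply: test_sph
  | apply: testD | apply: testZ | apply: testM]].

(** Expand (E w - (1 - c) / 2 * w / t)^2 >= 0, where the cross term is half the
    derivative of w^2. *)
Lemma weighted_hardy c w : test w ->
  ((1 - c) / 2) ^+ 2 * Jb (c - 2) (fun x => w x * w x) <=
  Jb c (fun x => euler w x * euler w x).
Proof.
move=> tw; pose s := (1 - c) / 2.
have ta := test_euler tw.
have E1 : Jb (c - 1) (fun x => euler w x * w x) = s * Jb (c - 2) (fun x => w x * w x).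
  have tww : test (fun x => w x * w x) by tst.
  have := Jb_euler (c - 1) tww; rewrite (_ : c - 1 - 1 = c - 2); last by ring.
  rewrite (_ : euler _ = fun x => 2 * (euler w x * w x)); last first.
    by apply/funext => x; rewrite eulerM; [ring|apply: leibniz_smooth; exact: test_smooth tw].
  rewrite JbZ; last by tst.
  by rewrite /s; move: (Jb _ _) (Jb _ _) => u v; lra.
have : 0 <= Jb c (fun x => euler w x * euler w x) + - (2 * s) * Jb (c - 1) (fun x => euler w x * w x)
      + s ^+ 2 * Jb (c - 2) (fun x => w x * w x).
  rewrite /Jb -!IntZ; try (apply: cc_wt; tst).
  have cA : cc (fun x => euler w x * euler w x * wt (- n%:R) c x) by apply: cc_wt; tst.
  have cB : cc (fun x => - (2 * s) * (euler w x * w x * wt (- n%:R) (c - 1) x)).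
    by apply: ccZ; apply: cc_wt; tst.
  have cC : cc (fun x => s ^+ 2 * (w x * w x * wt (- n%:R) (c - 2) x)).
    by apply: ccZ; apply: cc_wt; tst.
  rewrite -(IntD cA cB) -IntD //; last exact: ccD.
  apply: Int_ge0 => x; have [/Oout ox|nox] := pselect (O x); last first.
    by rewrite (test_out0 tw nox) (test_out0 ta nox) !(mul0r,mulr0) !addr0.
  rewrite -wt_tau // -wt_tau2 //; have t0 := tau_gt0 ox.
  rewrite (_ : _ + _ = wt (- n%:R) c x * (euler w x - s * w x / tau x) ^+ 2).
    by rewrite mulr_ge0 ?sqr_ge0 // ltW // wt_gt0.
  by field; rewrite gt_eqF.
rewrite E1 -/s; set u := Jb c _; set v := Jb (c - 2) _; clearbody s u v; nra.
Qed.

Section rellich.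
Variables (A B c lamb : R) (w : 'rV[R]_n -> R).
Hypotheses (n2 : (2 <= n)%N) (lambE : lamb = B ^+ 2 - A ^+ 2) (B0 : B <= 0) (c0 : c <= 0).
Hypothesis gap : forall d, 0 <= (lamb - @sph_eig R n d) * (lamb - @sph_eig R n d + 1).
Hypothesis Ot : forall x, O x -> 1 <= tau x /\ c * (c - 1) + 2 * B * c <= tau x.
Hypothesis tw : test w.

Variables (a b m : 'rV[R]_n -> R).
Hypotheses (aE : a = euler w) (bE : b = euler a).
Hypothesis mE : m = fun x => lamb * w x + sph w x.

(** S commutes with the square root of the weight, which can thus be moved into w
    before [sph_spectral_gap] is applied. *)
Lemma rellich_gap (e : R) : 0 <= Jb e (fun x => m x * (m x + w x)).
Proof.
pose v x := w x * wt (- (n%:R / 2)) (e / 2) x.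
have tv : test v by exact: test_wt.
have := sph_spectral_gap n2 gap (test_rc2 tv).
congr (0 <= _); congr Int; apply/funext => x; rewrite /v sph_wtM // mE.
have -> : wt (- n%:R) e x = wt (- (n%:R / 2)) (e / 2) x * wt (- (n%:R / 2)) (e / 2) x.
  by rewrite wtM -opprD -!splitr.
ring.
Qed.

Let k1 : 0 <= c * (c - 1).
Proof. by rewrite mulr_le0 //; move: c0; lra. Qed.

Let k2 : 0 <= 2 * B * c.
Proof. by rewrite mulr_le0 // pmulr_rle0. Qed.

(** For large t the sum of the lower order weights is at most t^c, and where a
    weight multiplies w m it may be replaced by - m^2, by [rellich_gap]. *)
Lemma gap_absorbs :
  0 <= Jb c (fun x => m x * m x) + c * (c - 1) * Jb (c - 2) (fun x => w x * m x)
    + 2 * B * c * Jb (c - 1) (fun x => w x * m x).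
Proof.
have tS : test (sph w) by exact: test_sph.
have tm : test m by rewrite mE; tst.
have g2 := mulr_ge0 k1 (rellich_gap (c - 2)).
have g1 := mulr_ge0 k2 (rellich_gap (c - 1)).
have mm e : Jb e (fun x => m x * (m x + w x)) = Jb e (fun x => m x * m x) + Jb e (fun x => w x * m x).
  rewrite -JbD; [|by tst|by tst].
  by congr Jb; apply/funext => x; ring.
rewrite !mm in g1 g2.
have : c * (c - 1) * Jb (c - 2) (fun x => m x * m x) + 2 * B * c * Jb (c - 1) (fun x => m x * m x)
     <= Jb c (fun x => m x * m x).
  rewrite /Jb -!IntZ; try (apply: cc_wt; tst).
  have cm2 e : cc (fun x => m x * m x * wt (- n%:R) e x) by apply: cc_wt; tst.
  rewrite -IntD; [|exact: ccZ|exact: ccZ].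
  apply: Int_le => //; first by apply: ccD; exact: ccZ.
  move=> x; have [ox|nox] := pselect (O x); last first.
    by rewrite (test_out0 tm nox) !(mul0r,mulr0) addr0.
  have [t1 tk] := Ot ox; rewrite -(wt_tau _ _ (Oout ox)) -(wt_tau2 _ _ (Oout ox)).
  have W0 := wt_gt0 (- n%:R) c x; have t0 : 0 < tau x by lra.
  rewrite -subr_ge0 (_ : _ - _ = m x ^+ 2 * wt (- n%:R) c x / tau x ^+ 2 *
    (tau x ^+ 2 - (c * (c - 1) + 2 * B * c * tau x))); last first.
    by field; rewrite gt_eqF.
  apply: mulr_ge0.
    apply: divr_ge0; last exact: sqr_ge0.
    by apply: mulr_ge0; [exact: sqr_ge0|exact: ltW].
  by apply: quadratic_dominates.
set u := Jb c _; move: g1 g2.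
move: (Jb (c - 1) (fun x => m x * m x)) (Jb (c - 2) (fun x => m x * m x)) => u1 u2.
move: (Jb (c - 1) (fun x => w x * m x)) (Jb (c - 2) (fun x => w x * m x)) => u3 u4.
by rewrite !mulrDr; lra.
Qed.

(** Expand the square and integrate by parts in t. The coefficient of the integral
    of t^c a^2 becomes 4 B^2 - 2 lamb = 2 (A^2 + B^2), to which [weighted_hardy]
    applies. The remaining terms are nonnegative, some because B and c are not
    positive, or lower order and handled by [gap_absorbs]. *)
Lemma weighted_rellich :
  2 * (A ^+ 2 + B ^+ 2) * ((1 - c) / 2) ^+ 2 * Jb (c - 2) (fun x => w x * w x) <=
  Jb c (fun x => (b x - 2 * B * a x + m x) ^+ 2).
Proof.
have ta : test a by rewrite aE; exact: test_euler.
have tb : test b by rewrite bE; exact: test_euler.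
have tS : test (sph w) by exact: test_sph.
have tSa : test (sph a) by exact: test_sph.
have tm : test m by rewrite mE; tst.
have sw := test_smooth tw; have sa := test_smooth ta; have sm := test_smooth tm.
have ssw : smooth (sph w) by exact: smooth_sph.
have em x : euler m x = lamb * a x + sph a x.
  rewrite mE eulerD; [|by apply: smoothM => //; exact: smooth_cst|by []].
  by rewrite (@eulerZ _ _ lamb w x sw) (@euler_sphC _ _ w x sw) -aE.
(* b a is half the derivative of a^2 *)
have Eab : Jb c (fun x => b x * a x) = - c / 2 * Jb (c - 1) (fun x => a x * a x).
  have taa : test (fun x => a x * a x) by tst.
  have := Jb_euler c taa.
  rewrite (_ : euler _ = fun x => 2 * (b x * a x)); last first.
    by apply/funext => x; rewrite eulerM; [rewrite -bE; ring|exact: leibniz_smooth].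
  rewrite JbZ; last by tst.
  by move: (Jb _ _) (Jb _ _) => u v; lra.
(* the derivative of w m is a m + w (M a), and M is symmetric, so both terms
   have the same integral *)
have Eam e : Jb e (fun x => a x * m x) = - e / 2 * Jb (e - 1) (fun x => w x * m x).
  have twm : test (fun x => w x * m x) by tst.
  have := Jb_euler e twm.
  rewrite (_ : euler _ = fun x => a x * m x + (lamb * (w x * a x) + w x * sph a x)); last first.
    by apply/funext => x; rewrite eulerM ?em -?aE; [ring|exact: leibniz_smooth].
  rewrite JbD; [|by tst|by tst].
  rewrite JbD; [|by tst|by tst].
  rewrite JbZ; last by tst.
  rewrite -(Jb_sphC e tw ta).
  have -> : Jb e (fun x => a x * m x) = lamb * Jb e (fun x => w x * a x) + Jb e (fun x => sph w x * a x).
    rewrite -JbZ; last by tst.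
    rewrite -JbD; [|by tst|by tst].
    by congr Jb; apply/funext => x; rewrite mE; ring.
  by move: (Jb _ _) (Jb _ _) (Jb _ _) => u v z; lra.
(* the derivative of m is M a, because E commutes with S; the spherical part
   of a (M a) integrates to - P *)
pose P := 2^-1 * \sum_i \sum_j Jb c (fun x => rot i j a x * rot i j a x).
have P0 : 0 <= P.
  rewrite mulr_ge0 //; apply: sumr_ge0 => i _; apply: sumr_ge0 => j _.
  by apply: Jb_ge0 => x; rewrite -expr2 sqr_ge0.
have Ebm : Jb c (fun x => b x * m x) =
    - c * Jb (c - 1) (fun x => a x * m x) - lamb * Jb c (fun x => a x * a x) + P.
  have tam : test (fun x => a x * m x) by tst.
  have := Jb_euler c tam.
  rewrite (_ : euler _ = fun x => b x * m x + (lamb * (a x * a x) + sph a x * a x)); last first.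
    by apply/funext => x; rewrite eulerM ?em -?bE; [ring|exact: leibniz_smooth].
  rewrite JbD; [|by tst|by tst].
  rewrite JbD; [|by tst|by tst].
  rewrite JbZ; last by tst.
  rewrite (Jb_sph_grad c ta ta) -/P.
  by move: (Jb _ _) (Jb _ _) (Jb _ _) => u v z; lra.
have Eam1 := Eam (c - 1); rewrite (_ : c - 1 - 1 = c - 2) in Eam1; last by ring.
have Eam0 := Eam c.
have -> : Jb c (fun x => (b x - 2 * B * a x + m x) ^+ 2) =
   Jb c (fun x => b x * b x) + 4 * B ^+ 2 * Jb c (fun x => a x * a x)
   + Jb c (fun x => m x * m x) + - (4 * B) * Jb c (fun x => b x * a x)
   + 2 * Jb c (fun x => b x * m x) + - (4 * B) * Jb c (fun x => a x * m x).
  rewrite -!JbZ; try by tst.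
  rewrite -!JbD; try by tst.
  by congr Jb; apply/funext => x; ring.
have gap0 := gap_absorbs.
have hardy := weighted_hardy c tw; rewrite -aE in hardy.
have b2 : 0 <= Jb c (fun x => b x * b x) by apply: Jb_ge0 => x; rewrite -expr2 sqr_ge0.
have a2 : 0 <= Jb (c - 1) (fun x => a x * a x) by apply: Jb_ge0 => x; rewrite -expr2 sqr_ge0.
have a2c := mulr_ge0 k2 a2.
rewrite Ebm Eab Eam1 Eam0.
have AB : 0 <= 2 * (A ^+ 2 + B ^+ 2) by rewrite mulr_ge0 // addr_ge0 ?sqr_ge0.
have := ler_wpM2l AB hardy.
move: a2c gap0 P0 b2; rewrite lambE.
move: (Jb c (fun x => a x * a x)) (Jb _ (fun x => w x * w x)) (Jb c (fun x => b x * b x)) => u1 u2 u3.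
move: (Jb c (fun x => m x * m x)) (Jb (c - 1) (fun x => a x * a x)) => u4 u5.
move: (Jb (c - 1) (fun x => w x * m x)) (Jb (c - 2) (fun x => w x * m x)) => u6 u7.
exact: rellich_arith.
Qed.
End rellich.
End weighted_integral.

(** * Rellich and Hardy inequalities for one derivative step *)

Section laplacian_steps.
Context {R : realType} {n : nat}.
Implicit Types (f g p q : 'rV[R]_n -> R) (x : 'rV[R]_n).
Variable O : set 'rV[R]_n.
Hypothesis Oout : O `<=` outside.
Local Notation test := (test_function O).

Lemma wt_sqn2 a b x : outside x -> wt a b x / sqn x ^+ 2 = wt (a - 4) b x.
Proof.
move=> ox; rewrite (_ : a - 4 = a - 2 - 2); last by ring.
rewrite -!wt_sqn //; field; exact/lt0r_neq0/sqn_gt0.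
Qed.

Lemma wt_sqM e a b x : wt (- e) 0 x ^+ 2 * wt a b x = @wt R n (a - 2 * e) b x.
Proof. by rewrite expr2 !wtM !add0r (_ : - e + - e + a = a - 2 * e) //; ring. Qed.

Lemma unwt_sq (v : R) e a b x :
  (v * wt (- e) 0 x) ^+ 2 * wt a b x = v ^+ 2 * @wt R n (a - 2 * e) b x.
Proof. by rewrite exprMn -mulrA wt_sqM. Qed.

Lemma test_unwt e u : test u ->
  exists2 w, test w & u = fun x => w x * wt (- e) 0 x.
Proof.
move=> tu; exists (fun x => u x * wt e 0 x); first exact: test_wt.
by apply/funext => x; rewrite -mulrA wtM subrr addr0 wt00 mulr1.
Qed.

Lemma euler_unwt e w : test w ->
  euler (fun x => w x * wt (- e) 0 x) = fun x => (euler w x - e * w x) * wt (- e) 0 x.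
Proof. by move=> tw; apply/funext => x; rewrite (euler_wtM Oout) //; ring. Qed.

(** Conjugating the polar form of the Laplacian by |x|^e shifts E by - e. *)
Lemma laplacian_unwt e w x : test w -> O x ->
  laplacian (fun y => w y * wt (- e) 0 y) x =
  (euler (euler w) x + (n%:R - 2 - 2 * e) * euler w x
    + (e ^+ 2 - (n%:R - 2) * e) * w x + sph w x) * wt (- e) 0 x / sqn x.
Proof.
move=> tw Ox; have q0 := sqn_gt0 (Oout Ox).
have sw := test_smooth tw.
have su : smooth (fun y => w y * wt (- e) 0 y).
  by apply: (@test_smooth _ _ O); exact: test_wt.
have th : test (fun x => euler w x - e * w x).
  by apply: testB; [exact: test_euler|exact: testZ].
have ew : euler (fun x => euler w x - e * w x) x = euler (euler w) x - e * euler w x.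
  rewrite (_ : (fun y => _) = fun y => euler w y + - e * w y); last first.
    by apply/funext => y; rewrite mulNr.
  rewrite (@eulerD _ _ (euler w) (fun y => - e * w y)).
  - by rewrite (@eulerZ _ _ (- e) w x sw) mulNr.
  - exact: smooth_euler.
  - by apply: smoothM => //; exact: smooth_cst.
have := sphE x su; rewrite (sph_wtM Oout) // (euler_unwt e tw) (euler_unwt e th) ew => E.
apply: (mulfI (lt0r_neq0 q0)); rewrite [RHS]mulrC divfK ?gt_eqF //.
move/eqP: E; rewrite eq_sym subr_eq => /eqP E; move/eqP: E; rewrite subr_eq => /eqP ->.
ring.
Qed.

(** With e = A + B in [laplacian_unwt] the weight |x|^alpha becomes 1 / |x|^n and
    the operator becomes E^2 - 2 B E + B^2 - A^2 + S. *)
Lemma rellich_step (A B alpha c : R) (u : 'rV[R]_n -> R) : (2 <= n)%N ->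
  A = (n%:R - 2) / 2 -> B = (alpha - 2) / 2 -> B <= 0 -> c <= 0 ->
  (forall d, 0 <= (B ^+ 2 - A ^+ 2 - @sph_eig R n d) * (B ^+ 2 - A ^+ 2 - @sph_eig R n d + 1)) ->
  (forall x, O x -> 1 <= tau x /\ c * (c - 1) + 2 * B * c <= tau x) ->
  test u ->
  2 * gammabar n alpha * ((1 - c) / 2) ^+ 2 * Int (fun x => u x ^+ 2 * wt (alpha - 4) (c - 2) x)
  <= Int (fun x => laplacian u x ^+ 2 * wt alpha c x).
Proof.
move=> n2 AE BE B0 c0 gap Ot tu.
have [w tw uE] := test_unwt (A + B) tu.
have nE : n%:R = 2 * A + 2 by rewrite AE; field.
have aE : alpha = 2 * B + 2 by rewrite BE; field.
have H := weighted_rellich Oout n2 erefl B0 c0 gap Ot tw erefl erefl erefl.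
have E1 : Int (fun x => u x ^+ 2 * wt (alpha - 4) (c - 2) x) = Jb (c - 2) (fun x => w x * w x).
  apply: (congr1 (@Int R n)); apply/funext => x.
  rewrite uE unwt_sq expr2 (_ : alpha - 4 - 2 * (A + B) = - n%:R) //.
  by rewrite nE aE; ring.
have E2 : Int (fun x => laplacian u x ^+ 2 * wt alpha c x) =
    Jb c (fun x => (euler (euler w) x - 2 * B * euler w x
      + ((B ^+ 2 - A ^+ 2) * w x + sph w x)) ^+ 2).
  apply: (congr1 (@Int R n)); apply/funext => x; apply/esym.
  have [Ox|nOx] := pselect (O x); last first.
    rewrite (test_out0 (test_laplacian tu) nOx) (test_out0 tw nOx).
    rewrite (test_out0 (test_sph tw) nOx) (test_out0 (test_euler tw) nOx).
    rewrite (test_out0 (test_euler (test_euler tw)) nOx).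
    by rewrite !(mulr0, addr0, subr0) expr0n /= !mul0r.
  rewrite uE laplacian_unwt // nE.
  rewrite (_ : 2 * A + 2 - 2 - 2 * (A + B) = - (2 * B)); last by ring.
  rewrite (_ : (A + B) ^+ 2 - _ = B ^+ 2 - A ^+ 2); last by ring.
  have -> : wt (- (2 * A + 2)) c x = wt (- (A + B)) 0 x ^+ 2 * (wt alpha c x / sqn x ^+ 2).
    rewrite wt_sqn2; last exact: Oout.
    by rewrite wt_sqM (_ : alpha - 4 - 2 * (A + B) = - (2 * A + 2)) // aE; ring.
  rewrite mulNr addrA; field; exact/lt0r_neq0/sqn_gt0/Oout.
by rewrite /gammabar -AE -BE E1 E2; exact: H.
Qed.

(** The gradient is bounded below by its radial part. After v = |x|^-A w the
    radial part is E w - A w, whose cross term integrates to 0. *)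
Lemma gradient_hardy v : test v ->
  4^-1 * Int (fun x => v x ^+ 2 * wt (- 2) (- 2) x) <=
  Int (fun x => \sum_i partial i v x ^+ 2).
Proof.
move=> tv; pose A : R := (n%:R - 2) / 2.
have [w tw vE] := test_unwt A tv.
have nE : n%:R = 2 * A + 2 by rewrite /A; field.
have ta := test_euler tw.
have tww : test (fun x => w x * w x) by apply: testM.
have taa : test (fun x => euler w x * euler w x) by apply: testM.
have taw : test (fun x => euler w x * w x) by apply: testM.
have Eaw : Jb 0 (fun x => euler w x * w x) = 0.
  have := Jb_euler Oout 0 tww; rewrite oppr0 mul0r.
  rewrite (_ : euler _ = fun x => 2 * (euler w x * w x)); last first.
    by apply/funext => x; rewrite eulerM; [ring|apply: leibniz_smooth; exact: test_smooth tw].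
  by rewrite (JbZ Oout) // => /eqP; rewrite mulf_eq0 pnatr_eq0 /= => /eqP.
have H := weighted_hardy Oout 0 tw.
have -> : 4^-1 * Int (fun x => v x ^+ 2 * wt (- 2) (- 2) x) =
   ((1 - 0) / 2) ^+ 2 * Jb (0 - 2) (fun x => w x * w x).
  rewrite subr0 sub0r; congr (_ * _); first by field.
  congr Int; apply/funext => x; rewrite vE unwt_sq expr2 (_ : - 2 - 2 * A = - n%:R) //.
  by rewrite nE; ring.
apply: le_trans H _.
have E : Jb 0 (fun x => (euler w x - A * w x) ^+ 2) =
   Jb 0 (fun x => euler w x * euler w x) + A ^+ 2 * Jb 0 (fun x => w x * w x).
  have -> : (fun x => (euler w x - A * w x) ^+ 2) = fun x => euler w x * euler w x +
      (A ^+ 2 * (w x * w x) + - (2 * A) * (euler w x * w x)).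
    by apply/funext => x; ring.
  have t1 : test (fun x => A ^+ 2 * (w x * w x)) by exact: testZ.
  have t2 : test (fun x => - (2 * A) * (euler w x * w x)) by exact: testZ.
  rewrite (JbD Oout _ taa (testD t1 t2)) (JbD Oout _ t1 t2).
  by rewrite (JbZ Oout _ _ tww) (JbZ Oout _ _ taw) Eaw mulr0 addr0.
apply: (@le_trans _ _ (Jb 0 (fun x => (euler w x - A * w x) ^+ 2))).
  rewrite E lerDl mulr_ge0 ?sqr_ge0 //.
  by apply: Jb_ge0 => x; rewrite -expr2 sqr_ge0.
have tp i : test (partial i v) by exact: test_partial.
apply: Int_le.
- rewrite (_ : (fun x => _) = fun x => ((euler w x - A * w x) * (euler w x - A * w x)) * wt (- n%:R) 0 x).
    by apply: (cc_wt Oout); apply: testM; apply: testB => //; exact: testZ.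
  by apply/funext => x; rewrite expr2.
- apply: cc_sum => i; under eq_fun do rewrite expr2.
  by apply: ccM; exact: test_cc (tp i).
move=> x; have [Ox|nOx] := pselect (O x); last first.
  rewrite (test_out0 tw nOx) (test_out0 ta nOx) mulr0 subr0 expr0n /= mul0r.
  by apply: sumr_ge0 => i _; exact: sqr_ge0.
have q0 := sqn_gt0 (Oout Ox).
have -> : (euler w x - A * w x) ^+ 2 * wt (- n%:R) 0 x = euler v x ^+ 2 / sqn x.
  rewrite vE (euler_unwt A tw) exprMn -[RHS]mulrA; congr (_ * _).
  have -> : (sqn x)^-1 = wt (-2) 0 x.
    by rewrite -[- 2]sub0r -wt_sqn ?wt00 ?mul1r //; exact: Oout.
  by rewrite wt_sqM (_ : - 2 - 2 * A = - n%:R) // nE; ring.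
(* the radial part of the gradient is its orthogonal projection onto x *)
have : 0 <= \sum_i (partial i v x - euler v x / sqn x * x ord0 i) ^+ 2.
  by apply: sumr_ge0 => i _; exact: sqr_ge0.
rewrite (eq_bigr (fun i => partial i v x ^+ 2 + - (2 * (euler v x / sqn x)) * (x ord0 i * partial i v x)
    + (euler v x / sqn x) ^+ 2 * x ord0 i ^+ 2)); last by move=> i _; ring.
rewrite !big_split /= -!mulr_sumr -/(euler v x) -/(sqn x).
rewrite (_ : _ + _ = \sum_i partial i v x ^+ 2 - euler v x ^+ 2 / sqn x) ?subr_ge0 //.
by field; rewrite gt_eqF.
Qed.

End laplacian_steps.

(** All the terms of z are integers, and z (z + 1) >= 0 for an integer z. *)
Lemma integer_gap (R : realType) (l j d : nat) (z : R) :
  z = j%:R ^+ 2 - l%:R ^+ 2 - @sph_eig R (2 * l.+1) d -> 0 <= z * (z + 1).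
Proof.
move=> zE; pose Z : int := (j * j)%:Z - (l * l)%:Z - (d * (d + 2 * l))%:Z.
have -> : z = Z%:~R.
  rewrite zE /Z /sph_eig !rmorphB /= -!pmulrn !natrM natrD -natr1 natrM; ring.
rewrite -[1]/(1%:~R) -rmorphD -rmorphM /= ler0z.
move: Z => Z; nia.
Qed.

(** * Iteration on exterior domains *)

Section exterior_domain.
Context {R : realType} {n : nat}.
Implicit Types (f g p q : 'rV[R]_n -> R) (x : 'rV[R]_n).

Lemma exterior_enorm r x : exterior n r x -> r <= enorm x.
Proof.
by move=> nx; rewrite leNgt; apply/negP => xr; apply: nx; exact: subset_closure.
Qed.

Lemma sqn_ge0 x : 0 <= sqn x.
Proof. by apply: sumr_ge0 => i _; exact: sqr_ge0. Qed.

Lemma enorm_sqn x : enorm x ^+ 2 = sqn x.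
Proof. by rewrite sqr_sqrtr // sqn_ge0. Qed.

Lemma exterior_outside r : 1 < r -> exterior n r `<=` @outside R n.
Proof.
move=> r1 x /exterior_enorm rx; rewrite /outside /= -enorm_sqn.
by rewrite exprn_egt1 // (lt_le_trans r1).
Qed.

Lemma exterior_tau t x : 0 < t -> exterior n (expR t) x -> t <= tau x.
Proof.
move=> t0 ex; have r1 : 1 < expR t by rewrite expR_gt1.
have ox := exterior_outside r1 ex.
rewrite -(expRK t) -(tau_enorm ox) ler_ln ?posrE ?expR_gt0 //; first exact: exterior_enorm.
exact: lt_le_trans (expR_gt0 t) (exterior_enorm ex).
Qed.

Lemma wt_nat a b x : outside x ->
  wt (- a%:R) (- b%:R) x = (enorm x ^+ a * ln (enorm x) ^+ b)^-1.
Proof.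
move=> ox; rewrite wt_ln // (tau_enorm ox) -expRD !mulNr -opprD expRN expRD !expRM_natl.
have t0 := tau_gt0 ox; congr (_ ^+ _ * _ ^+ _)^-1.
  rewrite -(tau_enorm ox) lnK // posrE sqrtr_gt0; exact: sqn_gt0.
by rewrite lnK.
Qed.

Lemma integral_zero_ext O f g : (forall x, O x -> f x = g x) -> (forall x, ~ O x -> g x = 0) ->
  cc g -> (\int[lebesgue_rV R n]_(x in O) (f x)%:E)%E = (Int g)%:E.
Proof.
move=> fg g0 cg; rewrite -EFin_Int // integral_mkcond; apply: eq_integral => x _.
rewrite patchE; case: ifPn => [/set_mem /fg ->//|].
by rewrite notin_setE => /g0 ->.
Qed.

Lemma test_iter O k u : test_function O u -> test_function O (iter k (@laplacian R n) u).
Proof. by move=> tu; elim: k => //= k IH; exact: test_laplacian. Qed.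

End exterior_domain.

Section iteration.
Context {R : realType} (l K : nat).
Let n := (2 * l.+1)%N.
Variable O : set 'rV[R]_n.
Hypothesis Oout : O `<=` outside.
Hypothesis K1 : (0 < K)%N.
Hypothesis Ot : forall x, O x -> 14 * K%:R ^+ 2 <= tau x.

Definition rellich_cst (p k : nat) : R :=
  \prod_(i < k) (2 * gammabar n (- 4 * i%:R - 2 * p%:R : R)
                   * ((2 * i%:R + 1 + 2 * p%:R) / 2) ^+ 2).

Lemma rellich_cst_ge0 p k : 0 <= rellich_cst p k.
Proof.
apply: prodr_ge0 => i _; rewrite mulr_ge0 ?sqr_ge0 // mulr_ge0 //.
by rewrite addr_ge0 // sqr_ge0.
Qed.

(** Step i is [rellich_step] with B = - (2 i + 1 + p) and c = - (2 i + 2 p). For i < K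
    its threshold c (c - 1) + 2 B c is at most 2 K (2 K + 1) + 8 K^2, hence 14 K^2. *)
Lemma rellich_iter (p k : nat) : (p <= 1)%N -> (k <= K)%N ->
  forall u, test_function O u ->
  rellich_cst p k * Int (fun x => u x ^+ 2 * wt (- 4 * k%:R - 2 * p%:R) (- 2 * k%:R - 2 * p%:R) x)
  <= Int (fun x => iter k laplacian u x ^+ 2 * wt (- 2 * p%:R) (- 2 * p%:R) x).
Proof.
move=> p1; elim: k => [|k IH] kK u tu.
  by rewrite /rellich_cst big_ord0 mul1r !mulr0 !sub0r !mulNr.
have := IH (ltnW kK) _ (test_laplacian tu); rewrite -iterSr; apply: le_trans.
rewrite /rellich_cst big_ord_recr /= -/(rellich_cst p k) -mulrA ler_wpM2l ?rellich_cst_ge0 //.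
have K1r : 1 <= K%:R :> R by rewrite ler1n.
have kKr : k%:R + 1 <= K%:R :> R by rewrite natr1 ler_nat.
have p1r : p%:R <= 1 :> R by rewrite lern1.
have [k0 p0] : 0 <= k%:R :> R /\ 0 <= p%:R :> R by [].
have := @rellich_step R n O Oout l%:R (- (2 * k%:R + 1 + p%:R))
  (- 4 * k%:R - 2 * p%:R) (- 2 * k%:R - 2 * p%:R) u.
rewrite (_ : (1 - (- 2 * k%:R - 2 * p%:R)) / 2 = (2 * k%:R + 1 + 2 * p%:R) / 2); last by field.
rewrite (_ : - 4 * k%:R - 2 * p%:R - 4 = - 4 * k.+1%:R - 2 * p%:R); last by rewrite -natr1; ring.
rewrite (_ : - 2 * k%:R - 2 * p%:R - 2 = - 2 * k.+1%:R - 2 * p%:R); last by rewrite -natr1; ring.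
apply => //.
- by rewrite /n mulnS leq_addr.
- rewrite /n natrM -natr1; field.
- by field.
- lra.
- move=> d; apply: (@integer_gap R l (2 * k + 1 + p) d).
  have -> : (2 * k + 1 + p)%:R = 2 * k%:R + 1 + p%:R :> R.
    by rewrite natrD (natrD _ (2 * k)) natrM.
  by rewrite sqrrN.
- move=> x /Ot; set t := tau x => h; split; nra.
Qed.

Lemma rellich_cstE p k : rellich_cst p k =
  2 ^+ k * (\prod_(i < k) gammabar n (- 4 * i%:R - 2 * p%:R : R))
    * \prod_(i < k) ((2 * i%:R + 1 + 2 * p%:R) / 2) ^+ 2.
Proof.
rewrite /rellich_cst big_split /=; congr (_ * _).
by rewrite big_split /= prodr_const card_ord.
Qed.

End iteration.

Theorem theorem4p2 (R : realType) (k n l : nat) (k_gt0 : (0 < k)%N)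
    (l_bounds : (1 <= l <= 2 * k)%N) (n_eq : n = (2 * l)%N) :
  exists2 r : R, 1 < r &
    forall phi : 'rV[R]_n -> R, test_function (exterior n r) phi ->
      ((2 ^+ k * (\prod_(i < k) gammabar n (- 4 * i%:R : R))
         * (\prod_(i < k) ((2 * i%:R + 1) / 2) ^+ 2))%:E
       * \int[lebesgue_rV R n]_(x in exterior n r)
           (phi x ^+ 2 / (enorm x ^+ (4 * k) * ln (enorm x) ^+ (2 * k)))%:E
       <= \int[lebesgue_rV R n]_(x in exterior n r)
            (`|iter k laplacian phi x| ^+ 2)%:E)%E
      /\
      ((2 ^ (k%:Z - 2) * (\prod_(i < k) gammabar n (- 4 * i%:R - 2 : R))
         * (\prod_(i < k) ((2 * i%:R + 3) / 2) ^+ 2))%:E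
       * \int[lebesgue_rV R n]_(x in exterior n r)
           (phi x ^+ 2
            / (enorm x ^+ (4 * k + 2) * ln (enorm x) ^+ (2 * k + 2)))%:E
       <= \int[lebesgue_rV R n]_(x in exterior n r)
            (enorm (grad (iter k laplacian phi) x) ^+ 2)%:E)%E.
Proof.
case: l n_eq l_bounds => [|l]; first by [].
move=> -> _ {n}.
pose t : R := 14 * k%:R ^+ 2.
have kr : 1 <= k%:R :> R by rewrite ler1n.
have t0 : 0 < t by rewrite /t; nra.
exists (expR t); first by rewrite expR_gt1.
move=> phi tphi; set O := exterior _ _ in tphi *.
have Oout : O `<=` outside by apply: exterior_outside; rewrite expR_gt1.
have Ot x : O x -> 14 * k%:R ^+ 2 <= tau x by exact: exterior_tau.
have tk := test_iter k tphi.
have lhs a b : (\int[lebesgue_rV R (2 * l.+1)]_(x in O)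
      (phi x ^+ 2 / (enorm x ^+ a * ln (enorm x) ^+ b))%:E)%E
    = (Int (fun x => phi x ^+ 2 * wt (- a%:R) (- b%:R) x))%:E.
  apply: integral_zero_ext => [x Ox|x nOx|].
  - by rewrite wt_nat //; exact: Oout.
  - by rewrite (test_out0 tphi nOx) expr0n mul0r.
  - under eq_fun do rewrite expr2.
    by apply: (cc_wt Oout); exact: testM.
rewrite !lhs; split.
- rewrite (@integral_zero_ext _ _ _ _ (fun x => iter k laplacian phi x ^+ 2)); last 3 first.
  + by move=> x _; rewrite real_normK // num_real.
  + by move=> x nOx; rewrite (test_out0 tk nOx) expr0n.
  + by under eq_fun do rewrite expr2; apply: ccM; exact: test_cc tk.
  rewrite -EFinM lee_fin.
  have -> : (fun x => phi x ^+ 2 * wt (- (4 * k)%:R) (- (2 * k)%:R) x) =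
      fun x => phi x ^+ 2 * wt (- 4 * k%:R - 2 * 0%:R) (- 2 * k%:R - 2 * 0%:R) x.
    by rewrite mulr0 !subr0 !natrM !mulNr.
  have -> : (fun x => iter k laplacian phi x ^+ 2) =
      fun x => iter k laplacian phi x ^+ 2 * wt (- 2 * 0%:R) (- 2 * 0%:R) x.
    by apply/funext => x; rewrite !mulr0 wt00 mulr1.
  apply: le_trans (rellich_iter Oout k_gt0 Ot (leq0n 1) (leqnn k) tphi).
  rewrite rellich_cstE.
  under [X in _ <= _ * X * _ * _]eq_bigr do rewrite mulr0 subr0.
  by under [X in _ <= _ * X * _]eq_bigr do rewrite mulr0 addr0.
- rewrite (@integral_zero_ext _ _ _ _ (fun x => \sum_i partial i (iter k laplacian phi) x ^+ 2)); last 3 first.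
  + move=> x _; rewrite enorm_sqn /sqn.
    by apply: eq_bigr => i _; rewrite mxE.
  + move=> x nOx; rewrite big1 // => i _.
    by rewrite (test_out0 (test_partial i tk) nOx) expr0n.
  + apply: cc_sum => i; under eq_fun do rewrite expr2.
    by apply: ccM; exact: test_cc (test_partial i tk).
  rewrite -EFinM lee_fin.
  apply: le_trans (gradient_hardy Oout tk).
  have := rellich_iter Oout k_gt0 Ot (leqnn 1) (leqnn k) tphi.
  rewrite !mulr1 => H; have c4 : 0 <= 4^-1 :> R by [].
  apply: le_trans (ler_wpM2l c4 H); rewrite mulrA rellich_cstE.
  have -> : (fun x => phi x ^+ 2 * wt (- (4 * k + 2)%:R) (- (2 * k + 2)%:R) x) =
      fun x => phi x ^+ 2 * wt (- 4 * k%:R - 2) (- 2 * k%:R - 2) x.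
    by rewrite (natrD _ (4 * k)) (natrD _ (2 * k)) !natrM !mulNr !opprD.
  rewrite expfzDr ?pnatr_eq0 // -exprnP (_ : 2 ^ (- 2) = 4^-1 :> R); last first.
    by rewrite -exprnN; field.
  under [X in _ <= _ * (_ * X * _) * _]eq_bigr do rewrite mulr1.
  have shift3 (a : R) : 2 * a + 1 + 2 * 1 = 2 * a + 3 by ring.
  under [X in _ <= _ * (_ * X) * _]eq_bigr do rewrite shift3.
  by rewrite [_ * 4^-1]mulrC !mulrA.
Qed.
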